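(* Let $(\mathbf x_i)$ be the mean-zero $p$-dimensional linear process described in the context, satisfying the decay condition with constants $C_0$ and $\beta>1/2$, $\beta\notin\{3/4,1\}$. Assume that the innovations are sub-Gaussian: there is $C_\xi<\infty$ with $\|\xi_{1,1}\|_q:=(\mathbb E|\xi_{1,1}|^q)^{1/q}\le C_\xi q^{1/2}$ for all $q\ge1$. Assume $p\ge 3$ and $\log p\le n$. Let $$J_{n,p,\beta}=\begin{cases}(\log p/n)^{1/2}, & \beta>1,\\ (\log p/n)^{1/2}\vee(\log p/n^{2\beta-1}), & 3/4<\beta<1,\\ \log p/n^{2\beta-1}, & 1/2<\beta<3/4.\end{cases}$$ Let $\hat{\mathbf b}$ satisfy $\mathbb P(|\hat{\mathbf b}-\mathbf b|_\infty>c_br_b)\le 2p^{-C_b}$ for some constants $c_b,C_b>0$ and a rate $r_b\ge0$. Then there exist constants $C_1>1$, $C_2>0$ depending only on $\beta$, $C_0$ and $C_\xi$ such that for every $\lambda\ge c_br_b+C_1|\boldsymbol\theta|_1J_{n,p,\beta}$, with probability at least $1-2p^{-C_b}-2p^{-C_2}$, every solution $\hat{\boldsymbol\theta}=\hat{\boldsymbol\theta}(\lambda)$ satisfies, simultaneously for all $1\le w\le\infty$, $$|\hat{\boldsymbol\theta}-\boldsymbol\theta|_w\le\big[6D(5|\Sigma^{-1}|_{L^1}\lambda)\big]^{1/w}\big(2|\Sigma^{-1}|_{L^1}\lambda\big)^{1-1/w}.$$ In particular, if $\boldsymbol\theta\in\mathcal G_r(\nu,M_p)$ with $0\le r<1$,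 then with the choice $\lambda=c_br_b+C_1\nu^{1-r}M_pJ_{n,p,\beta}$, for each $w\in[1,\infty]$, $$\mathbb P\Big(|\hat{\boldsymbol\theta}-\boldsymbol\theta|_w\le C_3M_p^{1/w}\big[|\Sigma^{-1}|_{L^1}(M_pJ_{n,p,\beta}+r_b)\big]^{1-r/w}\Big)\ge1-2p^{-C_b}-2p^{-C_2},$$ where $C_3$ depends only on $r,\nu,w$ and $C_1$.
   Context: Setup: $\mathbf x_i=\sum_{m=0}^\infty A_m\boldsymbol\xi_{i-m}$, $i\in\mathbb Z$, where $A_m=(a_{m,jk})$ are $p\times p$ real matrices, $\boldsymbol\xi_i=(\xi_{i,1},\dots,\xi_{i,p})^\top$, and $(\xi_{i,j})_{i,j\in\mathbb Z}$ are i.i.d. with mean $0$ and variance $1$. Decay condition: $\max_{1\le j\le p}\big(\sum_{k=1}^pa_{m,jk}^2\big)^{1/2}\le C_0(1\vee m)^{-\beta}$ for all $m\ge0$. $\Sigma=\mathrm{cov}(\mathbf x_i)$ is assumed invertible, $\mathbf b\in\mathbb R^p$, $\boldsymbol\theta=\Sigma^{-1}\mathbf b$. Given $\mathbf x_1,\dots,\mathbf x_n$, $\hat S_n=n^{-1}\sum_{i=1}^n\mathbf x_i\mathbf x_i^\top$, and $\hat{\mathbf b}$ is an estimator of $\mathbf b$. The estimator is $\hat{\boldsymbol\theta}(\lambda)\in\arg\min_{\boldsymbol\eta\in\mathbb R^p}\{|\boldsymbol\eta|_1:|\hat S_n\boldsymbol\eta-\hat{\mathbf b}|_\infty\le\lambda\}$.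 Notation: $|\mathbf a|_w=(\sum_j|a_j|^w)^{1/w}$, $|\mathbf a|_\infty=\max_j|a_j|$; for a matrix $M$, $|M|_{L^1}=\max_k\sum_j|m_{jk}|$. $D(u)=\sum_{j=1}^p(|\theta_j|\wedge u)$ for $u\ge0$. For $0\le r<1$, $\mathcal G_r(\nu,M_p)=\{\boldsymbol\eta\in\mathbb R^p:\max_j|\eta_j|\le\nu,\ \sum_j|\eta_j|^r\le M_p\}$, with $\nu$ a constant (convention $0^0=0$).
   Formalization: The constant C_3 is allowed to depend on c_b as well as on r, ν, w and C_1; with C_3 independent of c_b the last bound is false (take b̂ = b, Σ = I, c_b r_b = 2, with r_b → 0 and n → ∞). *)

(* Defs.v *)
From HB Require Import structures.
From mathcomp Require Import all_boot all_order all_algebra.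
From mathcomp Require Import all_classical all_reals all_analysis.
Set Implicit Arguments. Unset Strict Implicit. Unset Printing Implicit Defensive.
Import Order.TTheory GRing.Theory Num.Theory.
Import numFieldNormedType.Exports.
Local Open Scope classical_set_scope.
Local Open Scope ring_scope.

Section defs.
Context {R : realType}.

Definition invw (w : \bar R) : R :=
  match w with EFin r => r^-1 | _ => 0 end.

Definition lwnorm (p : nat) (w : \bar R) (v : 'cV[R]_p) : R :=
  match w with
  | EFin r => (\sum_(j < p) `|v j ord0| `^ r) `^ r^-1
  | _ => \big[Num.max/0]_(j < p) `|v j ord0|
  end.

Definition l1norm (p : nat) (v : 'cV[R]_p) : R := \sum_(j < p) `|v j ord0|.
Definition supnorm (p : nat) (v : 'cV[R]_p) : R := \big[Num.max/0]_(j < p) `|v j ord0|.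

Definition L1mxnorm (p : nat) (M : 'M[R]_p) : R :=
  \big[Num.max/0]_(k < p) \sum_(j < p) `|M j k|.

Definition Dfun (p : nat) (theta : 'cV[R]_p) (u : R) : R :=
  \sum_(j < p) Num.min `|theta j ord0| u.

(* G_r(nu, M) with the convention 0^0 = 0 *)
Definition in_Gr (p : nat) (r nu M : R) (eta : 'cV[R]_p) : Prop :=
  (forall j, `|eta j ord0| <= nu) /\
  \sum_(j < p) (if eta j ord0 == 0 then 0 else `|eta j ord0| `^ r) <= M.

Definition Jrate (beta : R) (n p : nat) : R :=
  let L := ln p%:R / n%:R in
  let L' := ln p%:R / (n%:R `^ (2 * beta - 1)) in
  if 1 < beta then Num.sqrt L
  else if 3 / 4 < beta then Num.max (Num.sqrt L) L'
  else L'.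

Definition is_solution (p : nat) (S : 'M[R]_p) (bh : 'cV[R]_p) (lam : R)
    (eta : 'cV[R]_p) : Prop :=
  supnorm (S *m eta - bh) <= lam /\
  forall eta', supnorm (S *m eta' - bh) <= lam -> l1norm eta <= l1norm eta'.

Definition Sn {T : Type} (p : nat) (x : int -> 'I_p -> T -> R) (n : nat) (om : T)
    : 'M[R]_p :=
  (n%:R)^-1 *: \sum_(1 <= i < n.+1)
     ((\col_j x (i%:Z) j om) *m (\col_j x (i%:Z) j om)^T).

End defs.

Section prob.
Context {d : measure_display} {T : measurableType d} {R : realType}.
Variable P : probability T R.
Local Open Scope ereal_scope.

Definition mutually_independent {I : eqType} (X : I -> T -> R) : Prop :=
  forall (s : seq I) (B : I -> set R), uniq s ->
    (forall i, measurable (B i)) ->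
    P (\big[setI/setT]_(i <- s) (X i @^-1` B i)) =
    \prod_(i <- s) P (X i @^-1` B i).

Definition identically_distributed {I : Type} (X : I -> T -> R) : Prop :=
  forall i j (B : set R), measurable B -> P (X i @^-1` B) = P (X j @^-1` B).

Definition covmx (p : nat) (y : 'I_p -> T -> R) : 'M[R]_p :=
  \matrix_(j, k) fine (covariance P (y j) (y k)).

End prob.

(* Main.v *)
Require Import Defs.
From HB Require Import structures.
From mathcomp Require Import all_boot all_order all_algebra.
From mathcomp Require Import all_classical all_reals all_analysis.
From mathcomp Require Import measurable_realfun zify ring lra.
Import Order.TTheory GRing.Theory Num.Theory.
Import numFieldNormedType.Exports.
Local Open Scope classical_set_scope.
Local Open Scope ring_scope.

(* On the event where [|bhat - b|_oo <= cb rb] and [|Sn - Sigma|_max <= C1 J], [theta] is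
   feasible, and the usual Dantzig-selector argument gives the bounds on the error.

   The second event is handled by a Hanson-Wright inequality, obtained by integrating out
   the innovations one at a time. Sub-Gaussianity gives
   [E exp (a (xi^2 - 1) + b xi) <= exp (K (a^2 + b^2))] for small [a], so eliminating a variable
   from a centered quadratic form with matrix [B] leaves a form of the same kind, whose matrix
   is a rank-one update of [B]; all these matrices stay entrywise below any [G >= 0] with
   [|B| + 8 K G^2 <= G], and the form has log-mgf at most [8 K |G|_F^2].
   For the linear process [|B| <= s V^T V], where [V V^T] is dominated by the Toeplitz matrix
   [Theta] with entries of order [|u - v|^-alpha], [alpha = beta] or [2 beta - 1]. As
   [Theta^2 <= rho Theta], an admissible [G] is explicit, and [rho] and [|Theta|_F] are
   exactly the quantities that [J] balances. The infinite process is reached by Fatou's lemma,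
   and the same mgf bound for [n = 1], [s -> 0] identifies its covariance. *)

(** * Independence *)

(** The innovations are not Gaussian, so a quadratic form in them cannot be diagonalized by a
    rotation; only the elimination of one variable at a time respects independence. Each elimination
    leaves the square of a linear form in the remaining variables, with uncontrolled signs. Hence
    the domination is entrywise, by one [G] fixed for the whole recursion: passing from [a :: r] to
    [r] removes the term [G i a * G a j] from the matrix product, and that term is what the update
    costs. The price is absolute values everywhere; it is affordable because the decay condition
    bounds the rows of [A m] in Euclidean norm and Cauchy-Schwarz survives absolute values. No
    dimension [p] enters, since the Gram matrix [V V^T] is indexed by the [n] times only. The
    excluded [beta] are those where a power sum of exponent one would produce a logarithm:
    [covexp beta] passes 1 at [beta = 1], and [2 * covexp beta] passes 1 at [beta = 3/4]. The
    process is given only as an almost sure limit, so neither its mean nor its covariance is known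
    beforehand; both come out of the exponential bounds. *)

Section independence.
Context {d : measure_display} {T : measurableType d} {R : realType}.
Variable P : probability T R.
Context {I : eqType} (X : I -> T -> R).
Hypothesis mX : forall i, measurable_fun setT (X i).
Hypothesis indX : mutually_independent P X.

(** A pi-system generating the sigma-algebra of the variables listed in [r], cut to the product
    shape in which [mutually_independent] is stated. *)
Definition cylinder (r : seq I) : set (set T) :=
  [set A | exists2 B : I -> set R, (forall i, measurable (B i)) &
     A = \big[setI/setT]_(i <- r) (X i @^-1` B i)].

Lemma measurable_preimage_fam i (B : set R) : measurable B ->
  measurable (X i @^-1` B).
Proof. by move=> mB; rewrite -[X in measurable X]setTI; exact: mX. Qed.

Lemma cylinder_measurable r : cylinder r `<=` measurable.
Proof.
move=> _ [B mB ->]; apply: bigsetI_measurable => i _.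
exact: measurable_preimage_fam.
Qed.

Lemma cylinder_setI r : setI_closed (cylinder r).
Proof.
move=> _ _ [B mB ->] [C mC ->]; exists (fun i => B i `&` C i).
  by move=> i; exact: measurableI.
by rewrite -big_split.
Qed.

Lemma cylinder_setT r : cylinder r setT.
Proof. by exists (fun=> setT) => //; rewrite big1. Qed.

Lemma cylinder_coord r i (B : set R) : uniq r -> i \in r -> measurable B ->
  cylinder r (X i @^-1` B).
Proof.
move=> ur ir mB; exists (fun j => if j == i then B else setT).
  by move=> j; case: ifP.
rewrite (bigD1_seq i)//= eqxx big1 ?setIT// => j /negbTE ->.
exact: preimage_setT.
Qed.

Lemma cylinder_sigma_measurable r A : <<s cylinder r>> A -> measurable A.
Proof.
apply: smallest_sub; last exact: cylinder_measurable.
exact: sigma_algebra_measurable.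
Qed.

(** Both sides are finite measures in [A] that agree on the pi-system of cylinders, hence on the
    sigma-algebra it generates. *)
Lemma cylinder_indep r a (A : set T) (B : set R) : uniq (a :: r) ->
  <<s cylinder r>> A -> measurable B ->
  P (A `&` X a @^-1` B) = (P A * P (X a @^-1` B))%E.
Proof.
move=> /= /andP[ar ur] sA mB.
have mD := measurable_preimage_fam a _ mB.
pose c : {nonneg R} := NngNum (fine_ge0 (measure_ge0 P (X a @^-1` B))).
have -> : P (A `&` X a @^-1` B) = mrestr P mD A by [].
have cE : (c%:num%:E = P (X a @^-1` B))%E.
  by rewrite /= fineK// fin_num_measure.
have -> : (P A * P (X a @^-1` B))%E = mscale c P A.
  by rewrite /mscale/= -cE muleC.
apply: (@g_sigma_algebra_measure_unique _ R T (cylinder r) _ (fun=> setT)) => //.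
- exact: cylinder_measurable.
- by move=> _; exact: cylinder_setT.
- by rewrite bigcup_const.
- exact: cylinder_setI.
- move=> _ [C mC ->]; rewrite /mrestr /mscale/= /mscale/=.
  (* [C'] puts [B] at coordinate [a]; since [a] is not in [r], the sets used along [r] are unchanged
     and independence applies to [a :: r]. *)
  pose C' i := if i == a then B else C i.
  have E1 : \big[setI/setT]_(i <- r) (X i @^-1` C i) =
            \big[setI/setT]_(i <- r) (X i @^-1` C' i).
    apply: eq_big_seq => i ir; rewrite /C'; case: eqP => // ia.
    by rewrite -ia ir in ar.
  have mC' i : measurable (C' i) by rewrite /C'; case: ifP.
  have := indX (a :: r) C' _ mC'; rewrite /= ar ur => /(_ isT).
  rewrite !big_cons {1 2}/C' eqxx setIC -E1 => EE.
  rewrite [LHS]EE.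
  by rewrite E1 (indX r C')//= fineK ?fin_num_measure// /C' eqxx.
- move=> _; rewrite /= /mrestr.
  by rewrite ltey_eq fin_num_measure//; apply: measurableI.
Qed.

(** Conditioning on the variables in [r] without conditional expectations: the first component is
    the identity of [T], viewed through the coarser sigma-algebra, so the pair has a product law and
    Tonelli freezes everything but [X a]. *)
Lemma indep_integral_le r a (f : g_sigma_algebraType (cylinder r) * R -> \bar R)
    (g : g_sigma_algebraType (cylinder r) -> \bar R) :
  uniq (a :: r) ->
  measurable_fun [set: g_sigma_algebraType (cylinder r) * R] f ->
  (forall x, 0 <= f x)%E ->
  measurable_fun [set: g_sigma_algebraType (cylinder r)] g ->
  (forall w, 0 <= g w)%E ->
  (forall w, \int[P]_w' f (w, X a w') <= g w)%E ->
  (\int[P]_w f (w, X a w) <= \int[P]_w g w)%E.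
Proof.
move=> ur mf f0 mg g0 fg.
set T' := g_sigma_algebraType (cylinder r).
have mid : measurable_fun [set: T] (id : T -> T').
  by move=> _ A mA; rewrite setTI; exact: cylinder_sigma_measurable mA.
have mpair : measurable_fun [set: T] (fun w => (w : T', X a w)).
  exact: measurable_fun_pair.
pose idM : {mfun T >-> T'} := HB.pack (id : T -> T')
  (isMeasurableFun.Build _ _ _ _ _ mid).
pose XM : {mfun T >-> R} := HB.pack (X a) (isMeasurableFun.Build _ _ _ _ _ (mX a)).
pose pM : {mfun T >-> (T' * R)%type} := HB.pack (fun w => (w : T', X a w))
  (isMeasurableFun.Build _ _ _ _ _ mpair).
have -> : (\int[P]_w f (w, X a w) = \int[distribution P pM]_z f z)%E.
  by rewrite ge0_integral_distribution.
have -> : (\int[P]_w g w = \int[distribution P idM]_z g z)%E.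
  by rewrite ge0_integral_distribution.
have pE : forall Z : set (T' * R), measurable Z ->
    (distribution P idM \x distribution P XM)%E Z = distribution P pM Z.
  apply: product_measure_unique => A B mA mB.
  exact: (cylinder_indep r a A B).
have -> : (\int[distribution P pM]_z f z =
    \int[(distribution P idM \x distribution P XM)%E]_z f z)%E.
  by apply: eq_measure_integral => A mA _; apply/esym/pE.
rewrite fubini_tonelli1//.
apply: ge0_le_integral => //.
- by move=> x _; apply: integral_ge0.
- exact: measurable_fun_fubini_tonelli_F.
move=> w _; rewrite /fubini_F ge0_integral_distribution//; first exact: fg.
by apply: measurableT_comp => //; exact: measurable_pair1.
Qed.

Lemma cylinder_measurable_coord r i : uniq r -> i \in r ->
  measurable_fun [set: g_sigma_algebraType (cylinder r)] (X i).
Proof.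
move=> ur ir _ B mB; rewrite setTI; apply: sub_sigma_algebra.
exact: cylinder_coord.
Qed.

End independence.

(** * Sub-Gaussian variables *)

Section integral_tools.
Context {d : measure_display} {T : measurableType d} {R : realType}.
Variable P : probability T R.

Lemma fatou_bound (f_ : nat -> T -> R) (f : T -> R) (c : \bar R) :
  (forall n, measurable_fun setT (f_ n)) -> (forall n x, 0 <= f_ n x) ->
  measurable_fun setT f ->
  {ae P, forall x, f_ ^~ x @ \oo --> f x} ->
  (forall n, \int[P]_x (f_ n x)%:E <= c)%E ->
  (\int[P]_x (f x)%:E <= c)%E.
Proof.
move=> mf_ f_0 mf cvf fc.
have mEf_ n : measurable_fun setT (EFin \o f_ n) by exact/measurable_EFinP.
have mlim : measurable_fun setT (fun x => limn_einf (fun n => (f_ n x)%:E)).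
  rewrite /limn_einf; apply: measurableT_comp => //.
  apply: measurable_fun_limn_esup => n.
  by apply: measurableT_comp => //; exact: mEf_.
have -> : (\int[P]_x (f x)%:E = \int[P]_x limn_einf (fun n => (f_ n x)%:E))%E.
  apply: ae_eq_integral => //; first exact/measurable_EFinP.
  apply: filterS cvf => x cvx _ /=.
  have cvE : (fun n => (f_ n x)%:E) @ \oo --> (f x)%:E.
    by apply/fine_cvgP; split; [exact: nearW|exact: cvx].
  by have [-> _] := cvg_limn_einf_sup cvE.
have f0 n x : setT x -> (0 <= (EFin \o f_ n) x)%E by rewrite lee_fin.
apply: le_trans (fatou P measurableT mEf_ f0) _.
rewrite limn_einf_lim; apply: lime_le; first exact: is_cvg_einfs.
  apply: nearW => n; apply: le_trans (fc n).
  by apply: ereal_inf_lbound; exists n => /=.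
Qed.

Lemma ident_integral {I : Type} (X : I -> T -> R) (f : R -> \bar R) i j :
  (forall i, measurable_fun setT (X i)) -> identically_distributed P X ->
  measurable_fun setT f -> (forall x, 0 <= f x)%E ->
  (\int[P]_w f (X i w) = \int[P]_w f (X j w))%E.
Proof.
move=> mX idX mf f0.
pose XM k : {mfun T >-> R} := HB.pack (X k) (isMeasurableFun.Build _ _ _ _ _ (mX k)).
transitivity (\int[distribution P (XM i)]_y f y)%E.
  by rewrite ge0_integral_distribution.
transitivity (\int[distribution P (XM j)]_y f y)%E.
  by apply: eq_measure_integral => A mA _; exact: idX.
by rewrite ge0_integral_distribution.
Qed.

End integral_tools.

Section mgf.
Context {R : realType}.

Lemma expR_second_order (u : R) : expR u <= 1 + u + u ^+ 2 * expR `|u|.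
Proof.
have [u0|u0] := leP 0 u.
  rewrite ger0_norm//.
  have e1 : expR u - 1 <= u * expR u.
    have := expR_ge1Dx (- u); rewrite expRN => h.
    have ep := expR_gt0 u.
    have := ler_wpM2r (ltW ep) h; rewrite mulVf ?gt_eqF// => h2; lra.
  have := ler_wpM2l u0 e1; rewrite mulrA -expr2 => h3.
  suff : expR u - 1 - u <= u * (expR u - 1) by lra.
  have : 1 + u <= expR u by exact: expR_ge1Dx.
  have e2 : expR u - 1 <= u * expR u by [].
  by lra.
(* For [u < 0]: [e^u <= 1 / (1 - u)], and [(1 + u + u^2)(1 - u) = 1 - u^3 >= 1]. *)
rewrite ltr0_norm//.
have e1 : expR u * (1 - u) <= 1.
  rewrite -[leRHS](expRxMexpNx_1 u) ler_pM2l ?expR_gt0//.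
  by have := expR_ge1Dx (- u); lra.
have e2 : 1 <= expR (- u) by have := expR_ge1Dx (- u); lra.
have : u ^+ 2 <= u ^+ 2 * expR (- u) by rewrite ler_peMr// sqr_ge0.
have u2 : 0 <= u ^+ 2 by rewrite sqr_ge0.
suff : expR u <= 1 + u + u ^+ 2 by lra.
have pos : 0 < 1 - u by lra.
rewrite -(ler_pM2r pos); apply: le_trans e1 _.
have : 0 <= u ^+ 2 * (- u) by rewrite mulr_ge0//; lra.
rewrite (_ : (1 + u + u ^+ 2) * (1 - u) = 1 + u ^+ 2 * (- u)); first by lra.
by ring.
Qed.

(** Weak Stirling bound: [k^k / k!] is one term of the series of [e^k]. *)
Lemma expR_nat_le (k : nat) : (k%:R : R) ^+ k <= expR k%:R * k`!%:R.
Proof.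
case: k => [|k]; first by rewrite expr0 fact0 mulr1 expR0.
have := @expR_ge1Dxn R k.+1%:R k (ler0n _ _).
rewrite -(ler_pM2r (_ : 0 < (k.+1)`!%:R :> R)) ?ltr0n ?fact_gt0//.
rewrite mulrDl mulfVK ?pnatr_eq0 -?lt0n ?fact_gt0// => h.
by apply: le_trans h; rewrite mul1r lerDr ler0n.
Qed.

End mgf.

Section subgaussian.
Context {d : measure_display} {T : measurableType d} {R : realType}.
Variable P : probability T R.
Variables (X : T -> R) (C : R).
Hypothesis mX : measurable_fun setT X.
Hypothesis C0 : 0 < C.
Hypothesis momX : forall q : R, 1 <= q ->
  ('N[P]_(q%:E)[EFin \o X] <= (C * Num.sqrt q)%:E)%E.

Lemma even_moment_bound (k : nat) : (0 < k)%N ->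
  (\int[P]_w ((X w ^+ 2) ^+ k)%:E <= ((C ^+ 2 * 2 * k%:R) ^+ k)%:E)%E.
Proof.
move=> k0; set r : R := (k * 2)%:R.
have r1 : 1 <= r by rewrite /r ler1n muln_gt0 k0.
have r0 : r != 0 by rewrite gt_eqF// (lt_le_trans ltr01).
have -> : (\int[P]_w ((X w ^+ 2) ^+ k)%:E = \int[P]_w (`|(EFin \o X) w| `^ r))%E.
  apply: eq_integral => w _; rewrite [RHS]poweR_EFin /r powR_mulrn//.
  by rewrite mulnC exprM real_normK// num_real.
rewrite -poweR_Lnorm//.
have -> : (((C ^+ 2 * 2 * k%:R) ^+ k)%:E = (C * Num.sqrt r)%:E `^ r)%E.
  have CE : 0 <= C * Num.sqrt r by rewrite mulr_ge0// ltW.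
  rewrite poweR_EFin [in X in _ `^ X]/r powR_mulrn// [(k * 2)%N]mulnC exprM.
  rewrite [(C * _) ^+ 2]exprMn sqr_sqrtr ?(ltW (lt_le_trans ltr01 r1))//.
  by rewrite /r natrM [k%:R * _]mulrC mulrA.
apply: gt0_ler_poweR; [by rewrite (le_trans ler01)| | |exact: momX].
  by rewrite in_itv/= leey Lnorm_ge0.
by rewrite in_itv/= leey lee_fin mulr_ge0// ltW.
Qed.

Lemma half_geometric_le2 N : \sum_(0 <= k < N) (2^-1 : R) ^+ k <= 2.
Proof.
suff -> : \sum_(0 <= k < N) (2^-1 : R) ^+ k = 2 - 2 * 2^-1 ^+ N.
  by rewrite gerBl mulr_ge0// exprn_ge0.
elim: N => [|N ih]; first by rewrite big_geq// expr0; lra.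
by rewrite big_nat_recr//= ih exprS; lra.
Qed.

(** With moments [(2 C^2 k)^k] and [k^k <= e^k k!], the [k]-th term of the expanded exponential is
    at most [(2 e C^2 t)^k], and this [t] makes the ratio one half. *)
Lemma exp_square_integral (t : R) : t = (4 * expR 1 * C ^+ 2)^-1 ->
  (\int[P]_w (expR (t * X w ^+ 2))%:E <= 2%:E)%E.
Proof.
move=> tE.
have e0 : 0 < expR 1 :> R by exact: expR_gt0.
have t0 : 0 < t by rewrite tE invr_gt0 !mulr_gt0// exprn_gt0.
have mX2 k : measurable_fun setT (fun w => (X w ^+ 2) ^+ k).
  by apply: measurable_funX; exact: measurable_funX.
pose g k w := exp_coeff (t * X w ^+ 2) k.
have g0 k w : 0 <= g k w.
  by rewrite /g /exp_coeff /= divr_ge0// exprn_ge0// mulr_ge0 ?sqr_ge0// ltW.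
have gE k w : g k w = t ^+ k / k`!%:R * (X w ^+ 2) ^+ k.
  by rewrite /g /exp_coeff/= exprMn mulrAC.
have mg k : measurable_fun setT (g k).
  have -> : g k = (fun w => t ^+ k / k`!%:R * (X w ^+ 2) ^+ k).
    by apply/funext => w; exact: gE.
  exact: measurable_funM.
apply: (@fatou_bound _ _ _ P (fun N w => \sum_(0 <= k < N) g k w)) => //.
- by move=> N; apply: measurable_sum.
- by move=> N w; apply: sumr_ge0.
- by apply: measurableT_comp => //; apply: measurable_funM => //; exact: measurable_funX.
- by apply: aeW => w; exact: is_cvg_series_exp_coeff.
move=> N.
under eq_integral do rewrite -sumEFin.
rewrite ge0_integral_sum//; last 2 first.
- by move=> k; exact/measurable_EFinP.
- by move=> k w _; rewrite lee_fin.
apply: le_trans (_ : (\sum_(0 <= k < N) (2^-1 ^+ k)%:E <= _)%E); last first.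
  by rewrite sumEFin lee_fin half_geometric_le2.
apply: lee_sum => k _.
under eq_integral do rewrite gE EFinM.
rewrite ge0_integralZl_EFin//; last 3 first.
- by move=> w _; rewrite lee_fin exprn_ge0// sqr_ge0.
- exact/measurable_EFinP.
- by rewrite divr_ge0// exprn_ge0// ltW.
case: k => [|k].
  under eq_integral do rewrite expr0.
  rewrite integral_cst// [X in (_ * (_ * X))%E](_ : _ = 1%E); last exact: probability_setT.
  by rewrite !expr0 fact0 divr1 !mule1.
apply: le_trans (lee_wpmul2l _ (even_moment_bound k.+1 _)) _ => //.
  by rewrite lee_fin divr_ge0// exprn_ge0// ltW.
rewrite -EFinM lee_fin.
have -> : t ^+ k.+1 / (k.+1)`!%:R * (C ^+ 2 * 2 * k.+1%:R) ^+ k.+1 =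
    (t * (C ^+ 2 * 2)) ^+ k.+1 * (k.+1%:R ^+ k.+1 / (k.+1)`!%:R).
  by rewrite !exprMn; ring.
have -> : 2^-1 = t * (C ^+ 2 * 2) * expR 1 :> R.
  rewrite tE; field.
  by rewrite !gt_eqF// ?exprn_gt0.
rewrite [leRHS]exprMn ler_wpM2l//.
  by rewrite exprn_ge0// !mulr_ge0// ?exprn_ge0// ltW.
rewrite ler_pdivrMr ?ltr0n ?fact_gt0//.
by rewrite -expRM_natr mul1r expR_nat_le.
Qed.

End subgaussian.

Lemma integral_affine {d : measure_display} {T : measurableType d} {R : realType}
  (P : probability T R) (f g : T -> R) (a b c : R) :
  P.-integrable setT (EFin \o f) -> P.-integrable setT (EFin \o g) ->
  P.-integrable setT (fun w => (a * f w + b * g w + c)%:E) /\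
  (\int[P]_w (a * f w + b * g w + c)%:E =
   a%:E * (\int[P]_w (f w)%:E) + b%:E * (\int[P]_w (g w)%:E) + c%:E)%E.
Proof.
move=> iF iG.
have iC : P.-integrable setT (EFin \o (fun=> c)).
  exact: finite_measure_integrable_cst.
have -> : (fun w => (a * f w + b * g w + c)%:E) =
    ((fun w => a%:E * (f w)%:E) \+ (fun w => b%:E * (g w)%:E) \+ (fun=> c%:E))%E.
  by apply/funext => w /=; rewrite !EFinD !EFinM.
have iaF : P.-integrable setT (fun w => a%:E * (f w)%:E)%E by apply: integrableZl.
have ibG : P.-integrable setT (fun w => b%:E * (g w)%:E)%E by apply: integrableZl.
have iD := integrableD measurableT iaF ibG.
split; first exact: integrableD.
rewrite integralD//= integralD// !integralZl// integral_cst//.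
by rewrite [X in (c%:E * X)%E](_ : _ = 1%E) ?mule1//; exact: probability_setT.
Qed.

Section subgaussian_mgf.
Context {R : realType}.

Lemma square_le_exp (y : R) : 0 <= y -> y ^+ 2 <= expR (2 * y).
Proof.
move=> y0; rewrite mulr2n mulrDl mul1r expRD -expr2.
rewrite lerXn2r// ?nnegrE ?expR_ge0//.
by have := expR_ge1Dx y; lra.
Qed.

(** Small linear coefficient: the first-order term is kept exactly, because it will integrate to
    zero; the remainder has to be quadratic in [(a, b)], and all growth in [x] is pushed into
    [e^(4 delta x^2)]. *)
Lemma mgf_pointwise_small (delta a b x : R) : 0 < delta -> `|a| <= delta -> `|b| <= 1 ->
  expR (a * (x ^+ 2 - 1) + b * x) <= 1 + (a * (x ^+ 2 - 1) + b * x) +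
   (a ^+ 2 + b ^+ 2) * (2 * (delta ^- 2 + 1 + delta^-1)) *
     expR (delta + (4 * delta)^-1) * expR (4 * delta * x ^+ 2).
Proof.
move=> d0 ad b1; set u := a * _ + _; set y := delta * x ^+ 2.
have y0 : 0 <= y by rewrite mulr_ge0 ?sqr_ge0// ltW.
have di0 : 0 < delta^-1 by rewrite invr_gt0.
have xE : x ^+ 2 = delta^-1 * y by rewrite /y mulKf// gt_eqF.
have xabs : `|x| <= y + (4 * delta)^-1.
  have : 0 <= delta * (`|x| - (2 * delta)^-1) ^+ 2 by rewrite mulr_ge0 ?sqr_ge0// ltW.
  rewrite sqrrB real_normK ?num_real//.
  have -> : delta * (x ^+ 2 - `|x| * (2 * delta)^-1 *+ 2 + (2 * delta)^-1 ^+ 2) =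
     y - `|x| + (4 * delta)^-1.
    by rewrite /y; field; rewrite gt_eqF.
  by lra.
have uabs : `|u| <= 2 * y + (delta + (4 * delta)^-1).
  apply: le_trans (ler_normD _ _) _; rewrite !normrM.
  have h1 : `|a| * `|x ^+ 2 - 1| <= delta * (x ^+ 2 + 1).
    apply: ler_pM => //.
    by apply: le_trans (ler_normB _ _) _; rewrite normr1 ger0_norm ?sqr_ge0.
  have h2 : `|b| * `|x| <= 1 * `|x| by rewrite ler_wpM2r.
  by rewrite /y in xabs *; lra.
have usq : u ^+ 2 <= (a ^+ 2 + b ^+ 2) * (2 * (delta ^- 2 + 1 + delta^-1)) * expR (2 * y).
  have y2 := @square_le_exp y y0.
  have e1 : 1 <= expR (2 * y) by have := expR_ge1Dx (2 * y); lra.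
  have e2 : y <= expR (2 * y) by have := expR_ge1Dx (2 * y); lra.
  have h1 : u ^+ 2 <= 2 * (a * (x ^+ 2 - 1)) ^+ 2 + 2 * (b * x) ^+ 2.
    have := sqr_ge0 (a * (x ^+ 2 - 1) - b * x); rewrite /u; nra.
  apply: le_trans h1 _; rewrite !exprMn.
  have h2 : (x ^+ 2 - 1) ^+ 2 <= (delta ^- 2 + 1) * expR (2 * y).
    have : (x ^+ 2 - 1) ^+ 2 <= (x ^+ 2) ^+ 2 + 1 by have := sqr_ge0 x; nra.
    move/le_trans; apply; rewrite xE exprMn exprVn mulrDl mul1r lerD//.
    by rewrite ler_wpM2l// invr_ge0 exprn_ge0// ltW.
  have h3 : x ^+ 2 <= delta^-1 * expR (2 * y) by rewrite {1}xE ler_wpM2l// ltW.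
  set E := expR (2 * y) in e1 e2 h2 h3 *.
  have E0 : 0 <= E by exact: expR_ge0.
  have d2 : 0 < delta ^- 2 by rewrite invr_gt0 exprn_gt0.
  have p1 : a ^+ 2 * (x ^+ 2 - 1) ^+ 2 <= a ^+ 2 * ((delta ^- 2 + 1) * E).
    by rewrite ler_wpM2l ?sqr_ge0.
  have p2 : b ^+ 2 * x ^+ 2 <= b ^+ 2 * (delta^-1 * E) by rewrite ler_wpM2l ?sqr_ge0.
  have p3 : 0 <= a ^+ 2 * (delta^-1 * E) by rewrite mulr_ge0 ?sqr_ge0// mulr_ge0// ltW.
  have p4 : 0 <= b ^+ 2 * ((delta ^- 2 + 1) * E).
    by rewrite mulr_ge0 ?sqr_ge0// mulr_ge0// addr_ge0// ltW.
  by lra.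
apply: le_trans (expR_second_order u) _; rewrite lerD2l.
have -> : 4 * delta * x ^+ 2 = 2 * y + 2 * y by rewrite /y; ring.
set D := (a ^+ 2 + _) * _ in usq *.
apply: le_trans (_ : D * expR (2 * y) * expR (2 * y + (delta + (4 * delta)^-1)) <= _).
  by rewrite ler_pM ?sqr_ge0 ?expR_ge0// ler_expR.
by rewrite !expRD; apply/eqP/eqP; rewrite le_eqVlt; apply/orP; left; apply/eqP; ring.
Qed.

Lemma mgf_pointwise_large (delta a b x : R) : 0 < delta -> `|a| <= delta -> 1 <= `|b| ->
  expR (a * (x ^+ 2 - 1) + b * x) <=
    expR ((delta + (4 * delta)^-1) * b ^+ 2) * expR (4 * delta * x ^+ 2).
Proof.
move=> d0 ad b1; rewrite -expRD ler_expR.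
have bb : 1 <= b ^+ 2 by rewrite -real_normK ?num_real// expr_ge1.
have h1 : b * x <= delta * x ^+ 2 + (4 * delta)^-1 * b ^+ 2.
  have : 0 <= delta * (x - b * (2 * delta)^-1) ^+ 2 by rewrite mulr_ge0 ?sqr_ge0// ltW.
  have -> : delta * (x - b * (2 * delta)^-1) ^+ 2 =
     delta * x ^+ 2 - b * x + (4 * delta)^-1 * b ^+ 2.
    by field; rewrite gt_eqF.
  by lra.
have x2 : 0 <= x ^+ 2 by exact: sqr_ge0.
have h2 : a * (x ^+ 2 - 1) <= delta * (x ^+ 2 + 1).
  apply: le_trans (ler_norm _) _; rewrite normrM ler_pM//.
  by apply: le_trans (ler_normB _ _) _; rewrite normr1 ger0_norm.
have h3 : delta <= delta * b ^+ 2 by rewrite ler_peMr// ltW.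
have h4 : 0 <= delta * x ^+ 2 by rewrite mulr_ge0// ltW.
by lra.
Qed.

Lemma subgaussian_mgf (C : R) : 0 < C -> exists2 K : R, 1 <= K &
  forall (d : measure_display) (T : measurableType d) (P : probability T R) (X : T -> R),
  measurable_fun setT X -> ('E_P[X] = 0)%E -> ('V_P[X] = 1)%E ->
  (forall q : R, 1 <= q -> ('N[P]_(q%:E)[EFin \o X] <= (C * Num.sqrt q)%:E)%E) ->
  forall a b : R, `|a| <= K^-1 ->
  (\int[P]_w (expR (a * (X w ^+ 2 - 1) + b * X w))%:E <= (expR (K * (a ^+ 2 + b ^+ 2)))%:E)%E.
Proof.
move=> C0.
have e0 : 0 < expR 1 :> R by exact: expR_gt0.
set t := (4 * expR 1 * C ^+ 2)^-1.
have t0 : 0 < t by rewrite invr_gt0 !mulr_gt0// exprn_gt0.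
(* With [4 * delta = t], the exponential weight of the pointwise bounds is the one integrated by
   [exp_square_integral]. *)
have [delta d0 tE] : exists2 delta : R, 0 < delta & 4 * delta = t.
  by exists (t / 4); [rewrite divr_gt0|field].
have di0 : 0 < delta^-1 by rewrite invr_gt0.
have d2i0 : 0 < delta ^- 2 by rewrite invr_gt0 exprn_gt0.
set kap := delta + (4 * delta)^-1.
have k0 : 0 < kap by rewrite addr_gt0// invr_gt0 mulr_gt0.
set D := 2 * (delta ^- 2 + 1 + delta^-1) * expR kap * 2.
have D0 : 0 < D by rewrite !mulr_gt0 ?expR_gt0// !addr_gt0.
(* [delta^-1] forces [|a| <= delta], [D] serves the case [|b| <= 1], and [1 + kap] the other one,
   where the 1 turns the factor 2 into [e^(b^2)]. *)
exists (1 + delta^-1 + D + kap); first by lra.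
move=> d T P X mX EX VX momX a b ale.
have ad : `|a| <= delta.
  apply: le_trans ale _; rewrite -[leRHS]invrK lef_pV2 ?posrE//; by lra.
have mX2 : measurable_fun setT (fun w => X w ^+ 2) by exact: measurable_funX.
have mu : measurable_fun setT (fun w => a * (X w ^+ 2 - 1) + b * X w).
  by apply: measurable_funD; apply: measurable_funM => //; exact: measurable_funB.
have me : measurable_fun setT (fun w => expR (t * X w ^+ 2)).
  by apply: measurableT_comp => //; apply: measurable_funM.
have ie := @exp_square_integral _ _ _ P X C mX C0 momX t erefl.
have [b1|b1] := leP `|b| 1; last first.
  have h : (\int[P]_w (expR (a * (X w ^+ 2 - 1) + b * X w))%:E <= \int[P]_w ((expR (kap * b ^+ 2))%:E * (expR (t * X w ^+ 2))%:E))%E.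
    apply: ge0_le_integral => //.
    - by apply/measurable_EFinP; apply: measurableT_comp.
    - by apply/measurable_EFinP; apply: measurable_funM.
    - move=> w _; rewrite -EFinM lee_fin -tE; by apply: mgf_pointwise_large => //; exact: ltW.
  apply: le_trans h _; rewrite ge0_integralZl_EFin ?expR_ge0//; last exact/measurable_EFinP.
  apply: le_trans (lee_wpmul2l _ ie) _; first by rewrite lee_fin expR_ge0.
  rewrite -EFinM lee_fin.
  have bb : 1 <= b ^+ 2 by rewrite -real_normK ?num_real// expr_ge1// ltW.
  have h2 : 2 <= expR (b ^+ 2) by have := expR_ge1Dx (b ^+ 2); lra.
  apply: le_trans (ler_wpM2l (expR_ge0 _) h2) _.
  rewrite -expRD ler_expR.
  have aa : 0 <= a ^+ 2 by exact: sqr_ge0.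
  have p1 : 0 <= (1 + delta^-1 + D + kap) * a ^+ 2.
    by rewrite mulr_ge0//; lra.
  have p2 : 0 <= (delta^-1 + D) * b ^+ 2 by rewrite mulr_ge0 ?sqr_ge0//; lra.
  by lra.
have iX2 : P.-integrable setT (EFin \o (fun w => X w ^+ 2)).
  apply/integrableP; split; first exact/measurable_EFinP.
  under eq_integral do rewrite /= ger0_norm ?sqr_ge0//.
  have h : (\int[P]_w (X w ^+ 2)%:E <= ((C ^+ 2 * 2 * 1%:R) ^+ 1)%:E)%E.
    exact: (@even_moment_bound _ _ _ P X C C0 momX 1%N isT).
  exact: le_lt_trans h (ltry _).
have i1 : P.-integrable setT (EFin \o (fun=> 1 : R)).
  exact: finite_measure_integrable_cst.
have iX : P.-integrable setT (EFin \o X).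
  apply: (@le_integrable _ _ _ P _ measurableT _ (EFin \o (fun w => X w ^+ 2 + 1))).
  - exact/measurable_EFinP.
  - move=> w _ /=; rewrite lee_fin (@ger0_norm _ (X w ^+ 2 + 1)) ?addr_ge0 ?sqr_ge0//.
    rewrite -(@real_normK _ (X w)) ?num_real//.
    have := sqr_ge0 (`|X w| - 1); have := normr_ge0 (X w); nra.
  - rewrite (_ : EFin \o _ = (EFin \o (fun w => X w ^+ 2)) \+ (EFin \o (fun=> 1 : R)))//.
    exact: integrableD.
have EX0 : (\int[P]_w (X w)%:E = 0)%E by rewrite -EX unlock.
have EX2 : (\int[P]_w (X w ^+ 2)%:E = 1)%E.
  rewrite -VX /variance unlock EX unlock; apply: eq_integral => w _.
  transitivity ((X w - 0) * (X w - 0))%:E; last by [].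
  by rewrite subr0 expr2.
have uE : (fun w => a * (X w ^+ 2 - 1) + b * X w) =
    (fun w => a * X w ^+ 2 + b * X w - a) by apply/funext => w; ring.
have [iu Eu] := @integral_affine _ _ _ P _ _ a b (- a) iX2 iX.
rewrite EX0 EX2 mule0 adde0 mule1 -EFinD subrr in Eu.
set g := fun w => (a ^+ 2 + b ^+ 2) * (2 * (delta ^- 2 + 1 + delta^-1)) *
     expR kap * expR (t * X w ^+ 2).
have g0 w : 0 <= g w.
  by rewrite /g !mulr_ge0 ?expR_ge0 ?addr_ge0 ?sqr_ge0// ltW.
have mg : measurable_fun setT g by exact: measurable_funM.
have Eg : (\int[P]_w (g w)%:E <= (D * (a ^+ 2 + b ^+ 2))%:E)%E.
  under eq_integral do rewrite /g EFinM.
  rewrite ge0_integralZl_EFin//; last 2 first.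
  - exact/measurable_EFinP.
  - by rewrite !mulr_ge0 ?expR_ge0 ?addr_ge0 ?sqr_ge0// ltW.
  apply: le_trans (lee_wpmul2l _ ie) _.
    by rewrite lee_fin !mulr_ge0 ?expR_ge0 ?addr_ge0 ?sqr_ge0// ltW.
  by rewrite -EFinM lee_fin le_eqVlt; apply/orP; left; apply/eqP; rewrite /D; ring.
have ig : P.-integrable setT (EFin \o g).
  apply/integrableP; split; first exact/measurable_EFinP.
  under eq_integral do rewrite /= ger0_norm//.
  exact: le_lt_trans Eg (ltry _).
apply: le_trans (_ : (\int[P]_w (1 + (a * (X w ^+ 2 - 1) + b * X w) + g w)%:E <= _)%E).
  apply: ge0_le_integral => //.
  - by apply/measurable_EFinP; apply: measurableT_comp.
  - by apply/measurable_EFinP; apply: measurable_funD => //; apply: measurable_funD.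
  - move=> w _; rewrite lee_fin /g -tE; exact: mgf_pointwise_small.
have -> : (\int[P]_w (1 + (a * (X w ^+ 2 - 1) + b * X w) + g w)%:E =
   1 + \int[P]_w (g w)%:E)%E.
  have [_ E] := @integral_affine _ _ _ P _ _ 1 1 1 iu ig.
  rewrite Eu mule0 add0e mul1e addeC in E; rewrite -E.
  by apply: eq_integral => w _; congr EFin; ring.
apply: le_trans (_ : (1 + (D * (a ^+ 2 + b ^+ 2))%:E <= _)%E); first by rewrite leeD2l.
rewrite -EFinD lee_fin; apply: le_trans (expR_ge1Dx _) _; rewrite ler_expR.
rewrite ler_wpM2r ?addr_ge0 ?sqr_ge0//.
by lra.
Qed.

End subgaussian_mgf.

(** * Hanson-Wright inequality *)

Section hanson_wright.
Context {d : measure_display} {T : measurableType d} {R : realType}.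
Variable P : probability T R.
Context {I : eqType} (X : I -> T -> R) (K : R).
Hypothesis mX : forall i, measurable_fun setT (X i).
Hypothesis indX : mutually_independent P X.
Hypothesis K1 : 1 <= K.
Hypothesis mgfX : forall i a b, `|a| <= K^-1 ->
  (\int[P]_w (expR (a * (X i w ^+ 2 - 1) + b * X i w))%:E <=
    (expR (K * (a ^+ 2 + b ^+ 2)))%:E)%E.

(** Subtracting the trace centers the form for independent variables of mean 0 and variance 1. The
    linear part lets one mgf bound serve linear forms as well, with [B = 0]. *)
Definition centered_quad (r : seq I) (B : I -> I -> R) (l : I -> R) (w : T) : R :=
  \sum_(i <- r) \sum_(j <- r) B i j * X i w * X j w - \sum_(i <- r) B i i +
  \sum_(i <- r) l i * X i w.

(** [b] is random but determined by the variables of [r], so the one-variable bound applies with a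
    frozen coefficient. *)
Lemma integrate_out r a (q b : T -> R) (c : R) : uniq (a :: r) -> `|c| <= K^-1 ->
  measurable_fun [set: g_sigma_algebraType (cylinder X r)] q ->
  measurable_fun [set: g_sigma_algebraType (cylinder X r)] b ->
  (\int[P]_w (expR (q w + (c * (X a w ^+ 2 - 1) + b w * X a w)))%:E <=
   \int[P]_w (expR (q w + K * (c ^+ 2 + b w ^+ 2)))%:E)%E.
Proof.
move=> ur cK mq mb.
pose f (z : g_sigma_algebraType (cylinder X r) * R) : \bar R :=
  (expR (q z.1 + (c * (z.2 ^+ 2 - 1) + b z.1 * z.2)))%:E.
pose g (w : g_sigma_algebraType (cylinder X r)) : \bar R :=
  (expR (q w + K * (c ^+ 2 + b w ^+ 2)))%:E.
apply: (@indep_integral_le _ _ _ P _ X mX indX r a f g ur).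
- apply/measurable_EFinP; apply: measurableT_comp => //.
  have m1 := @measurable_fst _ _ (g_sigma_algebraType (cylinder X r)) R.
  have m2 := @measurable_snd _ _ (g_sigma_algebraType (cylinder X r)) R.
  apply: measurable_funD; first exact: measurableT_comp.
  apply: measurable_funD.
    by apply: measurable_funM => //; apply: measurable_funB => //; exact: measurable_funX.
  by apply: measurable_funM => //; exact: measurableT_comp.
- by move=> z; rewrite lee_fin expR_ge0.
- apply/measurable_EFinP; apply: measurableT_comp => //.
  apply: measurable_funD => //; apply: measurable_funM => //.
  by apply: measurable_funD => //; exact: measurable_funX.
- by move=> z; rewrite lee_fin expR_ge0.
move=> w; rewrite /f /g /=.
under eq_integral do rewrite expRD EFinM.
rewrite ge0_integralZl_EFin ?expR_ge0//; last first.
- apply/measurable_EFinP; apply: measurableT_comp => //.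
  apply: measurable_funD; apply: measurable_funM => //.
  by apply: measurable_funB => //; exact: measurable_funX.
rewrite expRD EFinM; apply: lee_wpmul2l; first by rewrite lee_fin expR_ge0.
exact: mgfX.
Qed.

Lemma centered_quad_measurable r B l : uniq r ->
  measurable_fun [set: g_sigma_algebraType (cylinder X r)] (centered_quad r B l).
Proof.
move=> ur.
(* Coordinates outside [r] become 0: measurability of a sum is asked of every summand, and only the
   variables in [r] have it for the small sigma-algebra. *)
pose Y i : g_sigma_algebraType (cylinder X r) -> R := if i \in r then X i else cst 0.
have mY i : measurable_fun [set: g_sigma_algebraType (cylinder X r)] (Y i).
  rewrite /Y; case: ifPn => // ir; exact: cylinder_measurable_coord.
have -> : centered_quad r B l = fun w =>
    \sum_(i <- r) \sum_(j <- r) B i j * Y i w * Y j w - \sum_(i <- r) B i i +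
    \sum_(i <- r) l i * Y i w.
  apply/funext => w; rewrite /centered_quad; congr (_ - _ + _).
    apply: eq_big_seq => i ir; apply: eq_big_seq => j jr.
    by rewrite /Y ir jr.
  by apply: eq_big_seq => i ir; rewrite /Y ir.
apply: measurable_funD.
  apply: measurable_funB => //.
  apply: measurable_sum => i; apply: measurable_sum => j.
  by apply: measurable_funM => //; exact: measurable_funM.
by apply: measurable_sum => i; exact: measurable_funM.
Qed.

Lemma linear_measurable r (l : I -> R) : uniq r ->
  measurable_fun [set: g_sigma_algebraType (cylinder X r)]
    (fun w => \sum_(i <- r) l i * X i w).
Proof.
move=> ur; have := @centered_quad_measurable r (fun _ _ => 0) l ur.
congr (measurable_fun _ _); apply/funext => w; rewrite /centered_quad.
under eq_bigr do under eq_bigr do rewrite !mul0r.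
under eq_bigr do rewrite big1_eq.
by rewrite !big1_eq subr0 add0r.
Qed.

Lemma centered_quad_cons a r B l w : (forall i j, B i j = B j i) ->
  centered_quad (a :: r) B l w = centered_quad r B l w +
   (B a a * (X a w ^+ 2 - 1) +
    (2 * (\sum_(j <- r) B a j * X j w) + l a) * X a w).
Proof.
move=> symB; rewrite /centered_quad !big_cons.
under [X in _ + X - _ + _]eq_bigr do rewrite big_cons.
rewrite big_split/=.
have E1 : \sum_(j <- r) B a j * X a w * X j w = X a w * \sum_(j <- r) B a j * X j w.
  by rewrite mulr_sumr; apply: eq_bigr => j _; ring.
have E2 : \sum_(i <- r) B i a * X i w * X a w = X a w * \sum_(j <- r) B a j * X j w.
  by rewrite mulr_sumr; apply: eq_bigr => j _; rewrite symB; ring.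
by rewrite E1 E2; ring.
Qed.

Lemma sqr_sum (r : seq I) (f : I -> R) :
  (\sum_(i <- r) f i) ^+ 2 = \sum_(i <- r) \sum_(j <- r) f i * f j.
Proof.
by rewrite expr2 mulr_suml; apply: eq_bigr => i _; rewrite mulr_sumr.
Qed.

(* Integrating out [X a] turns its linear coefficient into the rank-one update
   [8 K B a i B a j] of the remaining matrix; [G] dominates all iterates. *)
Lemma hanson_wright_mgf (r : seq I) (B G : I -> I -> R) (l : I -> R) : uniq r ->
  (forall i j, B i j = B j i) -> (forall i j, G i j = G j i) ->
  (forall i j, 0 <= G i j) ->
  (forall i j, i \in r -> j \in r ->
     `|B i j| + 8 * K * \sum_(k <- r) G i k * G k j <= G i j) ->
  (\int[P]_w (expR (centered_quad r B l w))%:E <=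
   (expR (8 * K * (\sum_(i <- r) \sum_(j <- r) G i j ^+ 2 + \sum_(i <- r) l i ^+ 2)))%:E)%E.
Proof.
have K0 : 0 < K by apply: lt_le_trans K1.
have K8 : 0 <= 8 * K by rewrite mulr_ge0// ltW.
elim: r B => [|a r ih] B ur symB symG G0 BG.
  rewrite !big_nil addr0 mulr0.
  under eq_integral do rewrite /centered_quad !big_nil subrr addr0.
  rewrite integral_cst// expR0 mul1e.
  by rewrite [X in (X <= _)%E](_ : _ = 1%E)//; exact: probability_setT.
have [ar ur'] : a \notin r /\ uniq r by move: ur => /= /andP.
have BG' i j : i \in a :: r -> j \in a :: r -> `|B i j| <= G i j.
  move=> ir jr; apply: le_trans (BG i j ir jr); rewrite lerDl mulr_ge0//.
  by apply: sumr_ge0 => k _; rewrite mulr_ge0.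
(* On the diagonal, domination gives [8 K (G a a)^2 <= G a a], so [G a a <= 1 / (8 K)]: the
   coefficient of the square of [X a] stays in the range of [mgfX]. *)
have Baa : `|B a a| <= K^-1.
  have aa : a \in a :: r by rewrite mem_head.
  apply: le_trans (BG' a a aa aa) _.
  have := BG a a aa aa; rewrite big_cons.
  set S := \sum_(j <- r) _ => h.
  have S0 : 0 <= S by apply: sumr_ge0 => k _; rewrite mulr_ge0.
  have h2 : 8 * K * (G a a * G a a) <= G a a.
    apply: le_trans h; rewrite -[leLHS]add0r lerD ?normr_ge0// ler_wpM2l//.
    by rewrite lerDl.
  rewrite -(ler_pM2l K0) divff ?gt_eqF//.
  have [g0|g0] := leP (G a a) 0; first by apply: le_trans (mulr_ge0_le0 (ltW K0) g0) ler01.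
  have : 8 * K * G a a <= 1 by rewrite -(ler_pM2r g0) mul1r; lra.
  by have := mulr_ge0 (ltW K0) (G0 a a); lra.
pose q := centered_quad r B l.
pose b w := 2 * (\sum_(j <- r) B a j * X j w) + l a.
have mq := @centered_quad_measurable r B l ur'.
have mlin := @linear_measurable r (B a) ur'.
have mb : measurable_fun [set: g_sigma_algebraType (cylinder X r)] b.
  by apply: measurable_funD => //; exact: measurable_funM.
under eq_integral do rewrite centered_quad_cons//.
apply: le_trans (@integrate_out r a q b _ ur Baa mq mb) _.
pose B' i j := B i j + 8 * K * (B a i * B a j).
(* [c] collects what is deterministic after [(2 L + l a)^2 <= 8 L^2 + 2 (l a)^2], where [L] is the
   linear form; its last sum recenters the updated diagonal. *)
pose c := K * B a a ^+ 2 + 2 * K * l a ^+ 2 + 8 * K * \sum_(j <- r) B a j ^+ 2.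
have toT (h : T -> R) : measurable_fun [set: g_sigma_algebraType (cylinder X r)] h ->
    measurable_fun [set: T] h.
  move=> mh _ A mA; have := mh measurableT A mA; rewrite !setTI.
  exact: cylinder_sigma_measurable.
have mq' := @centered_quad_measurable r B' l ur'.
apply: le_trans (_ : (\int[P]_w ((expR c)%:E * (expR (centered_quad r B' l w))%:E) <= _)%E).
  apply: ge0_le_integral => //.
  - apply/measurable_EFinP; apply: measurableT_comp => //.
    apply: measurable_funD; first exact: toT.
    apply: measurable_funM => //; apply: measurable_funD => //.
    by apply: measurable_funX; exact: toT.
  - apply/measurable_EFinP; apply: measurable_funM => //; apply: measurableT_comp => //.
    exact: toT.
  move=> w _; rewrite -EFinM lee_fin -expRD ler_expR /q /centered_quad.
  have -> : \sum_(i <- r) \sum_(j <- r) B' i j * X i w * X j w =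
      \sum_(i <- r) \sum_(j <- r) B i j * X i w * X j w +
      8 * K * (\sum_(i <- r) B a i * X i w) ^+ 2.
    rewrite sqr_sum mulr_sumr -big_split/=; apply: eq_bigr => i _.
    rewrite mulr_sumr -big_split/=; apply: eq_bigr => j _.
    by rewrite /B'; ring.
  have -> : \sum_(i <- r) B' i i = \sum_(i <- r) B i i + 8 * K * \sum_(i <- r) B a i ^+ 2.
    by rewrite mulr_sumr -big_split/=.
  rewrite /c /b; set L := \sum_(i <- r) B a i * X i w.
  have : (2 * L + l a) ^+ 2 <= 8 * L ^+ 2 + 2 * l a ^+ 2.
    by have := sqr_ge0 (2 * L - l a); nra.
  by move=> /(ler_wpM2l (ltW K0)); lra.
rewrite ge0_integralZl_EFin ?expR_ge0//; last first.
- by apply/measurable_EFinP; apply: measurableT_comp => //; exact: toT.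
apply: le_trans (lee_wpmul2l _ (ih B' ur' _ symG G0 _)) _.
- by rewrite lee_fin expR_ge0.
- by move=> i j; rewrite /B' symB [B a i * _]mulrC.
- move=> i j ir jr.
  have ir' : i \in a :: r by rewrite inE ir orbT.
  have jr' : j \in a :: r by rewrite inE jr orbT.
  (* The summand [k = a] of the product, absent from the condition on [r], pays for the rank-one
     update. *)
  have := BG i j ir' jr'; rewrite big_cons; apply: le_trans.
  rewrite mulrDr addrA lerD2r /B'; apply: le_trans (ler_normD _ _) _.
  rewrite lerD2l normrM ger0_norm// ler_wpM2l//.
  rewrite normrM ler_pM// ?BG' ?mem_head//.
  by rewrite symG BG' ?mem_head.
(* [c] is charged to [l a] and to row and column [a] of [G], the entries missing from the Frobenius
   sum over [r]. *)
rewrite -EFinM lee_fin -expRD ler_expR /c !big_cons.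
under [X in _ <= _ * (_ + X + _)]eq_bigr do rewrite big_cons.
rewrite big_split/=.
have sq : \sum_(j <- r) B a j ^+ 2 <= \sum_(j <- r) G a j ^+ 2.
  rewrite big_seq [leRHS]big_seq; apply: ler_sum => j jr.
  rewrite -real_normK ?num_real// lerXn2r ?nnegrE//.
  by rewrite BG' ?mem_head// inE jr orbT.
have saa : B a a ^+ 2 <= G a a ^+ 2.
  rewrite -real_normK ?num_real// lerXn2r ?nnegrE//.
  by rewrite BG' ?mem_head.
have s1 : 0 <= \sum_(i <- r) G i a ^+ 2 by apply: sumr_ge0 => i _; exact: sqr_ge0.
have s2 := ler_wpM2l (ltW K0) sq.
have s3 := ler_wpM2l (ltW K0) saa.
have s4 := mulr_ge0 (ltW K0) s1.
have s5 := mulr_ge0 (ltW K0) (sqr_ge0 (l a)).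
have s6 := mulr_ge0 (ltW K0) (sqr_ge0 (G a a)).
set S1 := \sum_(i <- r) G i a ^+ 2 in s1 s4 *.
by lra.
Qed.

End hanson_wright.

(** * Dominating matrices *)

Section dominating_matrix.
Context {R : realType}.

Definition lemx {m n : nat} (A B : 'M[R]_(m, n)) := forall i j, A i j <= B i j.

Lemma lemx_trans {m n} (B A C : 'M[R]_(m, n)) : lemx A B -> lemx B C -> lemx A C.
Proof. by move=> AB BC i j; exact: le_trans (AB i j) (BC i j). Qed.

Lemma lemxD {m n} (A A' B B' : 'M[R]_(m, n)) :
  lemx A A' -> lemx B B' -> lemx (A + B) (A' + B').
Proof. by move=> AA BB i j; rewrite !mxE lerD. Qed.

Lemma lemxZ {m n} (c : R) (A A' : 'M[R]_(m, n)) : 0 <= c ->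
  lemx A A' -> lemx (c *: A) (c *: A').
Proof. by move=> c0 AA i j; rewrite !mxE ler_wpM2l. Qed.

Lemma lemxZl {m n} (c c' : R) (A : 'M[R]_(m, n)) : c <= c' ->
  lemx 0 A -> lemx (c *: A) (c' *: A).
Proof. by move=> cc A0 i j; rewrite !mxE ler_wpM2r//; have := A0 i j; rewrite mxE. Qed.

Lemma lemx_mul {m n k} (A A' : 'M[R]_(m, n)) (B B' : 'M[R]_(n, k)) :
  lemx 0 A -> lemx 0 B -> lemx A A' -> lemx B B' -> lemx (A *m B) (A' *m B').
Proof.
move=> A0 B0 AA BB i j; rewrite !mxE; apply: ler_sum => l _.
by apply: ler_pM => //; [have := A0 i l|have := B0 l j]; rewrite mxE.
Qed.

Lemma mulmx_ge0 {m n k} (A : 'M[R]_(m, n)) (B : 'M[R]_(n, k)) :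
  lemx 0 A -> lemx 0 B -> lemx 0 (A *m B).
Proof.
move=> A0 B0 i j; rewrite !mxE; apply: sumr_ge0 => l _.
by apply: mulr_ge0; [have := A0 i l|have := B0 l j]; rewrite mxE.
Qed.

Lemma trmx_ge0 {m n} (A : 'M[R]_(m, n)) : lemx 0 A -> lemx 0 A^T.
Proof. by move=> A0 i j; have := A0 j i; rewrite !mxE. Qed.

Lemma scalemx_ge0 {m n} (c : R) (A : 'M[R]_(m, n)) : 0 <= c -> lemx 0 A -> lemx 0 (c *: A).
Proof. by move=> c0 A0 i j; have := A0 i j; rewrite !mxE => h; exact: mulr_ge0. Qed.

Lemma frobenius_trace {m n} (A : 'M[R]_(m, n)) :
  \sum_i \sum_j A i j ^+ 2 = \tr (A *m A^T).
Proof.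
rewrite /mxtrace; apply: eq_bigr => i _; rewrite mxE; apply: eq_bigr => j _.
by rewrite mxE expr2.
Qed.

(* [G = s V^T (1 + 4 kappa s Theta) V]: the almost idempotent [Theta] makes the
   Neumann series of the elimination collapse to its first two terms. *)
Lemma dominating_matrix (n N : nat) (V : 'M[R]_(n, N)) (Theta : 'M[R]_n)
    (rho kappa s : R) :
  lemx 0 V -> lemx 0 Theta -> Theta^T = Theta ->
  lemx (V *m V^T) Theta -> lemx (Theta *m Theta) (rho *: Theta) ->
  0 <= s -> 0 <= kappa -> 0 <= rho -> 4 * kappa * s * rho <= 1 ->
  exists G : 'M[R]_N, [/\ lemx 0 G, G^T = G,
    lemx (s *: (V^T *m V) + kappa *: (G *m G)) G &
    \sum_i \sum_j G i j ^+ 2 <= 4 * s ^+ 2 * \sum_u \sum_v Theta u v ^+ 2].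
Proof.
move=> V0 T0 symT GT TT s0 k0 r0 small.
set c := 4 * kappa * s.
have c0 : 0 <= c by rewrite !mulr_ge0.
set H := 1%:M + c *: Theta.
have id0 : lemx 0 (1%:M : 'M[R]_n) by move=> i j; rewrite !mxE; case: eqP.
have H0 : lemx 0 H by rewrite -[0]addr0; apply: lemxD => //; exact: scalemx_ge0.
have symH : H^T = H by rewrite /H linearD linearZ/= symT trmx1.
have Vt0 := trmx_ge0 _ V0.
(* [H Theta = Theta + c Theta^2 <= (1 + c rho) Theta], and the smallness hypothesis is
   [c rho <= 1]. *)
have HT : lemx (H *m Theta) (2 *: Theta).
  rewrite mulmxDl mul1mx -scalemxAl (_ : 2 *: Theta = Theta + 1 *: Theta); last first.
    by rewrite scale1r -[2]/(1 + 1) scalerDl scale1r.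
  apply: lemxD => //; apply: lemx_trans (lemxZ c _ _ c0 TT) _.
  by rewrite scalerA; apply: lemxZl.
have Gam0 : lemx 0 (V *m V^T) by exact: mulmx_ge0.
have HGam : lemx (H *m (V *m V^T)) (2 *: Theta).
  by apply: lemx_trans HT; apply: lemx_mul.
exists (s *: (V^T *m H *m V)); split.
- by apply: scalemx_ge0 => //; do 2!apply: mulmx_ge0 => //.
- by rewrite linearZ/= !trmx_mul trmxK symH mulmxA.
(* Factoring out [V^T] and [V] leaves [1 + kappa s H (V V^T) H]; as [H (V V^T) H <= 4 Theta], this
   is at most [1 + 4 kappa s Theta = H]. *)
- have -> : s *: (V^T *m V) + kappa *: ((s *: (V^T *m H *m V)) *m (s *: (V^T *m H *m V)))
      = s *: (V^T *m (1%:M + (kappa * s) *: (H *m (V *m V^T) *m H)) *m V).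
    rewrite mulmxDr mulmx1 mulmxDl scalerDr; congr (_ + _).
    rewrite -!scalemxAl -!scalemxAr -!scalemxAl !scalerA !mulmxA.
    by congr (_ *: _); ring.
  apply: lemxZ => //; apply: lemx_mul => //.
    apply: mulmx_ge0 => //; rewrite -[0]addr0; apply: lemxD => //.
    by apply: scalemx_ge0; [rewrite mulr_ge0|do 2!apply: mulmx_ge0 => //].
  apply: lemx_mul => //.
    rewrite -[0]addr0; apply: lemxD => //.
    by apply: scalemx_ge0; [rewrite mulr_ge0|do 2!apply: mulmx_ge0 => //].
  apply: lemxD => //.
  have HTH : lemx (H *m (V *m V^T) *m H) (4 *: Theta).
    apply: lemx_trans (_ : lemx _ (2 *: (Theta *m H))) _.
      by rewrite scalemxAl; apply: lemx_mul => //; exact: mulmx_ge0.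
    have -> : Theta *m H = H *m Theta.
      by rewrite mulmxDl mulmxDr mul1mx mulmx1 -scalemxAl -scalemxAr.
    have -> : 4 *: Theta = 2 *: (2 *: Theta) by rewrite scalerA -natrM.
    exact: lemxZ.
  apply: lemx_trans (lemxZ _ _ _ _ HTH) _; first by rewrite mulr_ge0.
  by rewrite scalerA /c; have -> : kappa * s * 4 = 4 * kappa * s by ring.
(* Cyclicity of the trace moves the computation from size [N] to size [n], where
   [H (V V^T) <= 2 Theta]. *)
- rewrite frobenius_trace linearZ/= -scalemxAl -scalemxAr scalerA linearZ/=.
  have -> : V^T *m H *m V *m (V^T *m H *m V)^T = V^T *m (H *m (V *m V^T) *m H *m V).
    by rewrite !trmx_mul trmxK symH !mulmxA.
  rewrite mxtrace_mulC.
  have -> : H *m (V *m V^T) *m H *m V *m V^T =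
      (H *m (V *m V^T)) *m (H *m (V *m V^T)) by rewrite !mulmxA.
  have -> : 4 * s ^+ 2 * (\sum_u \sum_v Theta u v ^+ 2) =
      (s * s) * \tr ((2 *: Theta) *m (2 *: Theta)).
    rewrite frobenius_trace symT -scalemxAl -scalemxAr scalerA linearZ/=.
    by ring.
  apply: ler_wpM2l; first exact: mulr_ge0.
  rewrite /mxtrace; apply: ler_sum => i _.
  by apply: lemx_mul => //; exact: mulmx_ge0.
Qed.

End dominating_matrix.

(** * Power sums and rates *)

Section power_sums.
Context {R : realType}.
Implicit Types (g : R) (h k m n N : nat).

Definition powdecay (g : R) (m : nat) : R := (maxn 1 m)%:R `^ (- g).

Lemma maxn1_gt0 m : 0 < (maxn 1 m)%:R :> R.
Proof. by rewrite ltr0n leq_max. Qed.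

Lemma maxn1_ge1 m : 1 <= (maxn 1 m)%:R :> R.
Proof. by rewrite ler1n leq_max. Qed.

Lemma powdecay_gt0 g m : 0 < powdecay g m.
Proof. by rewrite powR_gt0// maxn1_gt0. Qed.

Lemma powdecay_ge0 g m : 0 <= powdecay g m.
Proof. exact: powR_ge0. Qed.

Lemma powdecay0 g : powdecay g 0 = 1.
Proof. by rewrite /powdecay powR1. Qed.

Lemma powdecay1 g : powdecay g 1 = 1.
Proof. by rewrite /powdecay powR1. Qed.

Lemma powdecayM g g' m : powdecay g m * powdecay g' m = powdecay (g + g') m.
Proof.
rewrite /powdecay -powRD ?opprD//.
by apply/implyP => _; rewrite gt_eqF// maxn1_gt0.
Qed.

Lemma powdecay_sqr g m : powdecay g m ^+ 2 = powdecay (2 * g) m.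
Proof. by rewrite expr2 powdecayM; congr powdecay; ring. Qed.

Lemma powdecay_lexp g g' m : g <= g' -> powdecay g' m <= powdecay g m.
Proof. by move=> gg; apply: ler_powR; [exact: maxn1_ge1|rewrite lerN2]. Qed.

Lemma powdecayE g m : powdecay g m = expR (- g * ln (maxn 1 m)%:R).
Proof. by rewrite /powdecay /powR gt_eqF// maxn1_gt0. Qed.

Lemma powdecay_le_dilate g (c : R) k h : 0 <= g -> 1 <= c ->
  (maxn 1 h)%:R <= c * (maxn 1 k)%:R -> powdecay g k <= c `^ g * powdecay g h.
Proof.
move=> g0 c1 hk.
have c0 : 0 < c by apply: lt_le_trans c1.
rewrite !powdecayE /powR gt_eqF// -expRD ler_expR.
have : ln (maxn 1 h)%:R <= ln (c * (maxn 1 k)%:R).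
  by rewrite ler_ln ?posrE ?mulr_gt0// maxn1_gt0.
rewrite lnM ?posrE// ?maxn1_gt0// => /(ler_wpM2l g0); lra.
Qed.

Lemma powdecay_le g k h : 0 <= g -> (k <= h)%N -> powdecay g h <= powdecay g k.
Proof.
move=> g0 kh; have := @powdecay_le_dilate g 1 h k g0 (lexx 1).
rewrite powR1 !mul1r; apply.
by rewrite ler_nat geq_max leq_maxl/= leq_max kh orbT.
Qed.

Lemma ln_succ_ge m : (0 < m)%N -> (m.+1%:R : R)^-1 <= ln m.+1%:R - ln m%:R.
Proof.
move=> m0.
have mp : 0 < m%:R :> R by rewrite ltr0n.
have Mp : 0 < m.+1%:R :> R by rewrite ltr0n.
have x0 : 0 < m%:R / m.+1%:R :> R by rewrite divr_gt0.
have ln_le (x : R) : 0 < x -> ln x <= x - 1.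
  by move=> xp; have := expR_ge1Dx (ln x); rewrite lnK ?posrE//; lra.
have := ln_le _ x0.
rewrite ln_div ?posrE//.
have -> : m%:R / m.+1%:R - 1 = - (m.+1%:R : R)^-1.
  have -> : m%:R = m.+1%:R - 1 :> R by rewrite -natr1 addrK.
  by field; rewrite gt_eqF.
by move=> h; rewrite -lerN2 opprB.
Qed.

Lemma maxn1S m : maxn 1 m.+1 = m.+1.
Proof. by rewrite maxnC /maxn. Qed.

(** Integral comparison in discrete form: [m^(1-g)] plays the primitive, and its increment is
    estimated through [ln (m + 1) - ln m >= 1 / (m + 1)]. *)
Lemma powdecay_telescope_gt1 g m : 1 < g -> (0 < m)%N ->
  (g - 1) * powdecay g m.+1 <= powdecay (g - 1) m - powdecay (g - 1) m.+1.
Proof.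
move=> g1 m0.
have Mp : 0 < m.+1%:R :> R by rewrite ltr0n.
have -> : powdecay g m.+1 = powdecay (g - 1) m.+1 * (m.+1%:R)^-1.
  have -> : g = g - 1 + 1 by ring.
  rewrite -powdecayM; congr (_ * _); first by congr powdecay; ring.
  by rewrite /powdecay maxn1S powR_inv1.
have -> : powdecay (g - 1) m = powdecay (g - 1) m.+1 *
    expR ((g - 1) * (ln m.+1%:R - ln m%:R)).
  have mE : maxn 1 m = m by case: (m) m0 => // k _; exact: maxn1S.
  by rewrite !powdecayE maxn1S mE -expRD; congr expR; ring.
set f := powdecay _ _.
have f0 : 0 < f by exact: powdecay_gt0.
have e := expR_ge1Dx ((g - 1) * (ln m.+1%:R - ln m%:R)).
have l : (g - 1) * (m.+1%:R)^-1 <= (g - 1) * (ln m.+1%:R - ln m%:R).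
  by rewrite ler_wpM2l ?ln_succ_ge//; lra.
set E := expR _ in e *; set i := (m.+1%:R)^-1 in l *.
have h : f * ((g - 1) * i) <= f * (E - 1).
  by rewrite ler_pM2l// lerBrDl; apply: le_trans e; rewrite lerD2l.
by clearbody f E i; lra.
Qed.

(** As in the summable case, but the increment now involves [1 - e^(-y)] with [0 <= y <= 1], which
    is at least [y / 2]; hence the factor one half. *)
Lemma powdecay_telescope_lt1 g m : 0 < g < 1 -> (0 < m)%N ->
  (1 - g) / 2 * powdecay g m.+1 <= powdecay (g - 1) m.+1 - powdecay (g - 1) m.
Proof.
move=> /andP[g0 g1] m0.
have Mp : 0 < m.+1%:R :> R by rewrite ltr0n.
have -> : powdecay g m.+1 = powdecay (g - 1) m.+1 * (m.+1%:R)^-1.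
  have -> : g = g - 1 + 1 by ring.
  rewrite -powdecayM; congr (_ * _); first by congr powdecay; ring.
  by rewrite /powdecay maxn1S powR_inv1.
have -> : powdecay (g - 1) m = powdecay (g - 1) m.+1 *
    expR (- ((1 - g) * (ln m.+1%:R - ln m%:R))).
  have mE : maxn 1 m = m by case: (m) m0 => // k _; exact: maxn1S.
  by rewrite !powdecayE maxn1S mE -expRD; congr expR; ring.
set f := powdecay _ _.
have f0 : 0 < f by exact: powdecay_gt0.
set y := (1 - g) * (m.+1%:R)^-1.
have i1 : (m.+1%:R : R)^-1 <= 1 by rewrite invf_le1 ?ler1n.
have i0 : 0 < (m.+1%:R : R)^-1 by rewrite invr_gt0.
have y0 : 0 < y by rewrite mulr_gt0 ?subr_gt0.
have y1 : y <= 1.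
  by rewrite -[leRHS]mul1r ler_pM ?subr_ge0 ?gerBl// ltW.
have l : y <= (1 - g) * (ln m.+1%:R - ln m%:R).
  by rewrite ler_wpM2l ?ln_succ_ge ?subr_ge0// ltW.
have e : expR (- ((1 - g) * (ln m.+1%:R - ln m%:R))) <= expR (- y).
  by rewrite ler_expR lerN2.
have e2 : expR (- y) <= 1 - y / 2.
  have e3 := expR_ge1Dx y.
  have E0 := expR_gt0 (- y).
  have : expR (- y) * (1 + y) <= 1.
    by rewrite -[leRHS](expRxMexpNx_1 y) mulrC ler_pM2r.
  by nra.
set E := expR _ in e *.
have h : f * (y / 2) <= f * (1 - E).
  by rewrite ler_pM2l// lerBrDr -lerBrDl; exact: le_trans e e2.
rewrite mulrBr mulr1 in h; apply: le_trans h.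
by rewrite /y le_eqVlt; apply/orP; left; apply/eqP; ring.
Qed.

Lemma powdecay_tail g : 1 < g -> exists2 C : R, 0 <= C &
  forall h N, \sum_(h <= m < N) powdecay g m <= C * powdecay (g - 1) h.
Proof.
move=> g1; set C' := (g - 1)^-1.
have C'0 : 0 < C' by rewrite invr_gt0; lra.
have main h k : (0 < h)%N -> \sum_(h <= m < h + k.+1) powdecay g m <=
    (1 + C') * powdecay (g - 1) h - C' * powdecay (g - 1) (h + k).
  move=> h0; elim: k => [|k ih].
    rewrite addn1 big_nat1 addn0 mulrDl mul1r addrK powdecay_lexp//; lra.
  rewrite addnS big_nat_recr/=; last by rewrite leq_addr.
  have := @powdecay_telescope_gt1 g (h + k) g1.
  rewrite addn_gt0 h0 => /(_ isT) /(ler_wpM2l (ltW C'0)).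
  rewrite mulrA mulVf ?mul1r ?subr_eq0 ?gt_eqF// addnS => t1.
  rewrite addnS in ih; set x := \sum_(h <= i < _) _ in ih *; move: t1 ih.
  set y1 := powdecay _ _; set y2 := powdecay _ (h + k); set y3 := powdecay _ _.
  by clearbody C'; clear; lra.
have bound h N : (0 < h)%N -> \sum_(h <= m < N) powdecay g m <=
    (1 + C') * powdecay (g - 1) h.
  move=> h0; have [Nh|hN] := leqP N h.
    by rewrite big_geq// mulr_ge0 ?powdecay_ge0//; lra.
  have := @main h (N - h).-1 h0.
  rewrite prednK ?subn_gt0// subnKC 1?ltnW// => /le_trans; apply.
  by rewrite gerBl mulr_ge0 ?powdecay_ge0// ltW.
(* Telescoping needs a positive start; the extra 1 pays for the term [m = 0]. *)
exists (2 + C'); first by lra.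
move=> [|h] N; last first.
  apply: le_trans (bound _ _ _) _ => //.
  by rewrite ler_wpM2r ?powdecay_ge0//; lra.
case: N => [|N].
  by rewrite big_geq// mulr_ge0 ?powdecay_ge0//; lra.
rewrite big_nat_recl// -(big_add1 _ _ 0 N.+1 xpredT (powdecay g)).
by have := @bound 1%N N.+1 isT; rewrite !powdecay0 powdecay1; lra.
Qed.

Lemma powdecay_partial g : 0 < g < 1 -> exists2 C : R, 0 <= C &
  forall N, \sum_(0 <= m < N) powdecay g m <= C * powdecay (g - 1) N.
Proof.
move=> g01; have /andP[g0 g1] := g01; set C' := ((1 - g) / 2)^-1.
have C'0 : 0 < C' by rewrite invr_gt0; lra.
have main k : \sum_(0 <= m < k.+2) powdecay g m <= 2 + C' * powdecay (g - 1) k.+1.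
  elim: k => [|k ih].
    rewrite !big_nat_recr//= big_geq// powdecay0 !powdecay1.
    by lra.
  rewrite big_nat_recr//=.
  have := @powdecay_telescope_lt1 g k.+1 g01 isT.
  move=> /(ler_wpM2l (ltW C'0)).
  rewrite mulrA mulVf ?mul1r; last by rewrite mulf_neq0 ?invr_eq0 ?pnatr_eq0// subr_eq0 gt_eqF.
  move=> t1; set x := \sum_(0 <= i < _) _ in ih *; move: t1 ih.
  set y1 := powdecay _ _; set y2 := powdecay _ _; set y3 := powdecay _ _.
  by clearbody C'; clear; lra.
have ge1 N : 1 <= powdecay (g - 1) N.
  by rewrite -(powdecay0 0) /powdecay oppr0 powR1 -{1}(powRr0 (maxn 1 N)%:R) ler_powR ?maxn1_ge1//; lra.
exists (2 + C'); first by lra.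
move=> [|[|N]].
- by rewrite big_geq// mulr_ge0 ?powdecay_ge0//; lra.
- by rewrite big_nat1 powdecay0 powdecay1; lra.
apply: le_trans (main N) _.
have := ge1 N.+2.
have mon : powdecay (g - 1) N.+1 <= powdecay (g - 1) N.+2.
  rewrite !powdecayE ler_expR ler_wpM2l//; first by lra.
  by rewrite ler_ln ?posrE ?maxn1_gt0// ler_nat !maxn1S.
have := ler_wpM2l (ltW C'0) mon.
by lra.
Qed.

End power_sums.

(** * Covariance decay and the rate [J] *)

Section long_memory_rates.
Context {R : realType}.
Implicit Types (h k m n N : nat).

Definition covexp (beta : R) : R := if 1 < beta then beta else 2 * beta - 1.

Lemma covexp_gt0 beta : 1 / 2 < beta -> 0 < covexp beta.
Proof. by rewrite /covexp; case: ifP => _; lra. Qed.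

(** For [beta > 1] the first factor is summable. For [beta < 1] the sum splits at [m = h]: before it
    the second factor is at most [h^(-beta)] and the first sums to order [h^(1 - beta)]; after it
    the product is at most [m^(-2 beta)], whose tail has order [h^(1 - 2 beta)]. *)
Lemma powdecay_convolution (beta : R) : 1 / 2 < beta -> beta != 1 ->
  exists2 C : R, 0 <= C & forall h N,
    \sum_(0 <= m < N) powdecay beta m * powdecay beta (m + h) <= C * powdecay (covexp beta) h.
Proof.
move=> b12 bn1; have b0 : 0 <= beta by lra.
rewrite /covexp; have [b1|b1] := ltP 1 beta.
  have [C C0 CP] := powdecay_tail _ b1.
  exists C => // h N.
  apply: le_trans (_ : \sum_(0 <= m < N) powdecay beta m * powdecay beta h <= _).
    apply: ler_sum => m _; rewrite ler_wpM2l ?powdecay_ge0// powdecay_le//.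
    exact: leq_addl.
  rewrite -mulr_suml ler_wpM2r ?powdecay_ge0//.
  by have := CP 0%N N; rewrite powdecay0 mulr1.
have b1' : beta < 1 by rewrite lt_neqAle bn1.
have [C C0 CP] : exists2 C : R, 0 <= C &
    forall N, \sum_(0 <= m < N) powdecay beta m <= C * powdecay (beta - 1) N.
  by apply: powdecay_partial; rewrite b1'; lra.
have [D D0 DP] : exists2 C : R, 0 <= C &
    forall h N, \sum_(h <= m < N) powdecay (2 * beta) m <= C * powdecay (2 * beta - 1) h.
  by apply: powdecay_tail; lra.
exists (C + D) => [|h N]; first exact: addr_ge0.
have near_part M : (M <= h)%N ->
    \sum_(0 <= m < M) powdecay beta m * powdecay beta (m + h) <= C * powdecay (2 * beta - 1) h.
  move=> Mh.
  apply: le_trans (_ : \sum_(0 <= m < M) powdecay beta m * powdecay beta h <= _).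
    apply: ler_sum => m _; rewrite ler_wpM2l ?powdecay_ge0// powdecay_le//.
    exact: leq_addl.
  rewrite -mulr_suml.
  apply: le_trans (_ : (C * powdecay (beta - 1) h) * powdecay beta h <= _).
    rewrite ler_wpM2r ?powdecay_ge0//; apply: le_trans (CP h).
    rewrite [leRHS](big_cat_nat _ (n := M))//= lerDl.
    by apply: sumr_ge0 => m _; exact: powdecay_ge0.
  rewrite -mulrA powdecayM le_eqVlt; apply/orP; left; apply/eqP.
  by congr (_ * powdecay _ _); ring.
have [Nh|hN] := leqP N h.
  apply: le_trans (near_part _ Nh) _; rewrite ler_wpM2r ?powdecay_ge0//.
  by rewrite lerDl.
rewrite (big_cat_nat _ (n := h)) ?(ltnW hN)//= mulrDl; apply: lerD; first exact: near_part.
apply: le_trans (DP h N); apply: ler_sum => m _.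
rewrite -powdecay_sqr expr2 ler_wpM2l ?powdecay_ge0// powdecay_le//.
exact: leq_addr.
Qed.

Definition natdist (u v : nat) : nat := ((u - v) + (v - u))%N.

Lemma natdistC u v : natdist u v = natdist v u.
Proof. by rewrite /natdist addnC. Qed.

Lemma natdist_triangle u v x : (natdist u v <= natdist u x + natdist x v)%N.
Proof. by rewrite /natdist; lia. Qed.

(** A given distance to [u] is attained at most twice. *)
Lemma sum_natdist (f : nat -> R) (n : nat) (u : 'I_n) : (forall h, 0 <= f h) ->
  \sum_(x < n) f (natdist u x) <= 2 * \sum_(0 <= h < n) f h.
Proof.
move=> f0; rewrite -(big_mkord xpredT (fun x => f (natdist u x))).
have un : (u <= n)%N by rewrite ltnW.
have part M : (M <= n)%N -> \sum_(0 <= h < M) f h <= \sum_(0 <= h < n) f h.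
  move=> Mn; rewrite [leRHS](big_cat_nat _ (n := M))//= lerDl.
  by apply: sumr_ge0.
rewrite (big_cat_nat _ (n := u))//= mulr2n mulrDl mul1r; apply: lerD.
  rewrite big_nat_rev/= add0n.
  have -> : \sum_(0 <= i < u) f (natdist u (u - i.+1)) = \sum_(0 <= i < u) f i.+1.
    apply: eq_big_nat => i /andP[_ iu]; congr f; rewrite /natdist; lia.
  apply: le_trans (part u.+1 _) => //.
  by rewrite big_nat_recl// lerDr.
rewrite -{1}[val u]add0n big_addn.
have -> : \sum_(0 <= i < n - u) f (natdist u (i + u)) = \sum_(0 <= i < n - u) f i.
  apply: eq_big_nat => i /andP[_ iu]; congr f; rewrite /natdist; lia.
by apply: part; rewrite leq_subr.
Qed.

Definition covmajorant (alpha c : R) (n : nat) : 'M[R]_n :=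
  \matrix_(u, v) (c * powdecay alpha (natdist u v)).

(** Of the distances from [x] to [u] and to [v], one is at least half of that from [u] to [v]; its
    factor is at most [2^alpha] times the target entry, and the other factor is summed over [x].
    Having a partial sum in the constant covers the non-summable exponents too. *)
Lemma covmajorant_sq (alpha c : R) n : 0 <= alpha -> 0 <= c ->
  lemx (covmajorant alpha c n *m covmajorant alpha c n)
    ((4 * 2 `^ alpha * c * \sum_(0 <= h < n) powdecay alpha h) *: covmajorant alpha c n).
Proof.
move=> a0 c0 u v; rewrite !mxE.
set S := \sum_(0 <= h < n) _; set p := powdecay alpha (natdist u v).
have bd (x : 'I_n) : powdecay alpha (natdist u x) * powdecay alpha (natdist x v) <=
    2 `^ alpha * p * (powdecay alpha (natdist u x) + powdecay alpha (natdist v x)).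
  have P0 := @powdecay_ge0 R alpha.
  have two0 : 0 <= 2 `^ alpha :> R by exact: powR_ge0.
  rewrite [natdist v x]natdistC mulrDr.
  have [h|h] := leqP (natdist u v) (2 * natdist u x).
    have : powdecay alpha (natdist u x) <= 2 `^ alpha * p.
      apply: powdecay_le_dilate => //; first by rewrite ler1n.
      by rewrite -natrM ler_nat; lia.
    move=> /(ler_wpM2r (P0 (natdist x v))) h2; apply: le_trans h2 _.
    by rewrite lerDr mulr_ge0 ?mulr_ge0// ?P0.
  have : powdecay alpha (natdist x v) <= 2 `^ alpha * p.
    apply: powdecay_le_dilate => //; first by rewrite ler1n.
    by rewrite -natrM ler_nat; have := natdist_triangle u v x; lia.
  move=> /(ler_wpM2l (P0 (natdist u x))) h2; apply: le_trans h2 _.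
  by rewrite mulrC lerDl mulr_ge0 ?mulr_ge0// ?P0.
have -> : \sum_j covmajorant alpha c n u j * covmajorant alpha c n j v =
    c ^+ 2 * \sum_(j < n) (powdecay alpha (natdist u j) * powdecay alpha (natdist j v)).
  by rewrite mulr_sumr; apply: eq_bigr => j _; rewrite !mxE; ring.
have -> : 4 * 2 `^ alpha * c * S * (c * p) = c ^+ 2 * (2 `^ alpha * p * (2 * S + 2 * S)).
  by ring.
rewrite ler_wpM2l ?sqr_ge0//.
apply: le_trans (ler_sum _ (fun x _ => bd x)) _.
rewrite -mulr_sumr ler_wpM2l ?mulr_ge0 ?powR_ge0// big_split/= lerD//;
  by apply: sum_natdist => h; exact: powdecay_ge0.
Qed.

Lemma covmajorant_frobenius (alpha c : R) n :
  \sum_u \sum_v covmajorant alpha c n u v ^+ 2 <=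
    2 * c ^+ 2 * n%:R * \sum_(0 <= h < n) powdecay (2 * alpha) h.
Proof.
apply: le_trans (_ : \sum_(u < n) (2 * c ^+ 2 * \sum_(0 <= h < n) powdecay (2 * alpha) h) <= _).
  apply: ler_sum => u _.
  have -> : \sum_v covmajorant alpha c n u v ^+ 2 =
      c ^+ 2 * \sum_(v < n) powdecay (2 * alpha) (natdist u v).
    by rewrite mulr_sumr; apply: eq_bigr => v _; rewrite mxE exprMn powdecay_sqr.
  rewrite -mulrA mulrCA ler_wpM2l ?sqr_ge0//.
  by apply: sum_natdist => h; exact: powdecay_ge0.
by rewrite sumr_const card_ord -mulr_natr le_eqVlt; apply/orP; left; apply/eqP; ring.
Qed.

(** What matters is a lower bound away from 0, which allows trading [ln p] for its square. *)
Lemma ln_ge_half (p : nat) : (3 <= p)%N -> 1 / 2 <= ln (p%:R : R).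
Proof.
move=> p3; rewrite -ler_expR lnK ?posrE ?ltr0n ?(leq_trans _ p3)//.
apply: le_trans (_ : 3 <= _); last by rewrite ler_nat.
have E0 := expR_gt0 (1 / 2 : R).
have := expR_ge1Dx (- (1 / 2) : R).
have := expRxMexpNx_1 (1 / 2 : R).
set x := expR _; set y := expR _ => xy y1.
have : x * (1 / 2) <= 1 by rewrite -[leRHS]xy ler_pM2l//; lra.
by lra.
Qed.

(* The two quantities of the Hanson-Wright bound (operator norm and squared Frobenius
   norm) at deviation level [n J]. *)
Lemma rate_bounds (beta : R) : 1 / 2 < beta -> beta != 3 / 4 -> beta != 1 ->
  exists2 c : R, 0 < c & forall n p : nat, (3 <= p)%N -> ln (p%:R : R) <= n%:R ->
    [/\ 0 < Jrate beta n p,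
      ln p%:R * \sum_(0 <= h < n) powdecay (covexp beta) h <= c * (n%:R * Jrate beta n p) &
      ln p%:R * (n%:R * \sum_(0 <= h < n) powdecay (2 * covexp beta) h) <=
        c * (n%:R * Jrate beta n p) ^+ 2].
Proof.
move=> b12 b34 b1.
suff main : exists C D : R, [/\ 0 <= C, 0 <= D & forall n p : nat, (0 < n)%N ->
    1 / 2 <= ln (p%:R : R) -> ln (p%:R : R) <= n%:R ->
    [/\ 0 < Jrate beta n p,
      ln p%:R * \sum_(0 <= h < n) powdecay (covexp beta) h <= C * (n%:R * Jrate beta n p) &
      ln p%:R * (n%:R * \sum_(0 <= h < n) powdecay (2 * covexp beta) h) <=
        D * (n%:R * Jrate beta n p) ^+ 2]].
  have [C [D [C0 D0 CD]]] := main; exists (C + D + 1) => [|n p p3 pn].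
    by rewrite ltr_pwDr// addr_ge0.
  have L0 := ln_ge_half p p3.
  have n0 : (0 < n)%N by rewrite -(ltr0n R); lra.
  have [J0 CJ DJ] := CD n p n0 L0 pn; split => //.
  - apply: le_trans CJ _; rewrite ler_wpM2r ?mulr_ge0 ?(ltW J0)//; lra.
  - apply: le_trans DJ _; rewrite ler_wpM2r ?sqr_ge0//; lra.
have sqrtJ (n p : nat) : (0 < n)%N -> 1 / 2 <= ln (p%:R : R) -> ln (p%:R : R) <= n%:R ->
  [/\ 0 < Num.sqrt (ln p%:R / n%:R : R),
     (n%:R * Num.sqrt (ln p%:R / n%:R)) ^+ 2 = ln p%:R * n%:R :> R &
     ln p%:R <= n%:R * Num.sqrt (ln p%:R / n%:R) :> R].
  move=> n0 L0 Ln; have N0 : 0 < n%:R :> R by rewrite ltr0n.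
  have L1 : 0 < ln (p%:R : R) by lra.
  have E : (n%:R * Num.sqrt (ln p%:R / n%:R)) ^+ 2 = ln p%:R * n%:R :> R.
    rewrite exprMn sqr_sqrtr; last by rewrite divr_ge0// ltW.
    by field; rewrite gt_eqF.
  split => //; first by rewrite sqrtr_gt0 divr_gt0.
  (* Squaring reduces the claim to [ln p <= n]. *)
  rewrite -(@ler_pXn2r _ 2) ?nnegrE ?mulr_ge0 ?sqrtr_ge0 ?(ltW L1) ?(ltW N0)//.
  by rewrite E expr2 ler_pM2l.
have LE (n p : nat) (al : R) : (0 < n)%N ->
   n%:R * (ln p%:R / n%:R `^ al) = ln p%:R * powdecay (al - 1) n :> R.
  move=> n0; have N0 : n%:R != 0 :> R by rewrite pnatr_eq0 -lt0n.
  have -> : powdecay (al - 1) n = n%:R / n%:R `^ al :> R.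
    have nE : maxn 1 n = n by case: (n) n0 => // k _; exact: maxn1S.
    rewrite /powdecay nE opprB powRB; last by rewrite N0 implybT.
    by rewrite powRr1.
  by ring.
have low0 (al : R) (n : nat) : 0 <= \sum_(0 <= h < n) powdecay al h.
  by apply: sumr_ge0 => h _; exact: powdecay_ge0.
rewrite /Jrate /covexp; have [b1'|b1'] := ltP 1 beta.
  have [C C0 CP] := powdecay_tail _ b1'.
  have [D D0 DP] : exists2 C : R, 0 <= C &
      forall h N, \sum_(h <= m < N) powdecay (2 * beta) m <= C * powdecay (2 * beta - 1) h.
    by apply: powdecay_tail; lra.
  exists C, D; split => // n p n0 L0 Ln; have [Q0 QE LQ] := sqrtJ n p n0 L0 Ln.
  have L1 : 0 <= ln (p%:R : R) by lra.
  split => //.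
    have := CP 0%N n; rewrite powdecay0 mulr1 => h.
    apply: le_trans (ler_wpM2l L1 h) _.
    by rewrite mulrC ler_wpM2l.
  rewrite QE mulrA mulrC ler_wpM2r ?mulr_ge0//.
  by have := DP 0%N n; rewrite powdecay0 mulr1.
have bl1 : beta < 1 by rewrite lt_neqAle b1.
have [C C0 CP] : exists2 C : R, 0 <= C &
    forall N, \sum_(0 <= m < N) powdecay (2 * beta - 1) m <= C * powdecay (2 * beta - 1 - 1) N.
  by apply: powdecay_partial; lra.
have [b3|b3] := ltP (3 / 4) beta.
  have [D D0 DP] : exists2 C : R, 0 <= C &
      forall h N, \sum_(h <= m < N) powdecay (2 * (2 * beta - 1)) m <=
        C * powdecay (2 * (2 * beta - 1) - 1) h.
    by apply: powdecay_tail; lra.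
  exists C, D; split => // n p n0 L0 Ln; have [Q0 QE LQ] := sqrtJ n p n0 L0 Ln.
  have L1 : 0 <= ln (p%:R : R) by lra.
  (* Between 3/4 and 1 each arm of the maximum has its own duty: [ln p / n^(2 beta - 1)] controls
     the operator norm quantity, the square root the Frobenius one. *)
  set J := Num.max _ _.
  have JQ : Num.sqrt (ln p%:R / n%:R) <= J by rewrite le_max lexx.
  have JL : ln p%:R / n%:R `^ (2 * beta - 1) <= J by rewrite le_max lexx orbT.
  have J0 : 0 < J by apply: lt_le_trans JQ.
  split => //.
    apply: le_trans (ler_wpM2l L1 (CP n)) _.
    by rewrite mulrCA ler_wpM2l// -LE// ler_wpM2l.
  apply: le_trans (_ : D * (n%:R * Num.sqrt (ln p%:R / n%:R)) ^+ 2 <= _).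
    rewrite QE mulrA mulrC ler_wpM2r ?mulr_ge0//.
    by have := DP 0%N n; rewrite powdecay0 mulr1.
  rewrite ler_wpM2l// lerXn2r ?nnegrE ?mulr_ge0 ?(ltW J0) ?(ltW Q0)//.
  by rewrite ler_wpM2l.
have bl3 : beta < 3 / 4 by rewrite lt_neqAle b34.
have [D D0 DP] : exists2 C : R, 0 <= C &
    forall N, \sum_(0 <= m < N) powdecay (2 * (2 * beta - 1)) m <=
      C * powdecay (2 * (2 * beta - 1) - 1) N.
  by apply: powdecay_partial; lra.
exists C, (2 * D); split => // [|n p n0 L0 Ln]; first exact: mulr_ge0.
have L1 : 0 <= ln (p%:R : R) by lra.
have N0 : 0 < n%:R :> R by rewrite ltr0n.
rewrite LE//; split.
- by rewrite divr_gt0 ?powR_gt0//; lra.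
- by apply: le_trans (ler_wpM2l L1 (CP n)) _; rewrite mulrCA.
rewrite exprMn powdecay_sqr.
apply: le_trans (ler_wpM2l L1 (ler_wpM2l (ltW N0) (DP n))) _.
have -> : n%:R * (D * powdecay (2 * (2 * beta - 1) - 1) n) =
    D * powdecay (2 * (2 * beta - 1 - 1)) n.
  have nE : maxn 1 n = n by case: (n) n0 => // k _; exact: maxn1S.
  have {1}-> : n%:R = powdecay (- 1) n :> R.
    by rewrite /powdecay nE opprK powRr1// ltW.
  by rewrite mulrCA powdecayM; congr (_ * powdecay _ _); ring.
set W := powdecay _ _.
have W0 : 0 <= W by exact: powdecay_ge0.
(* The Frobenius quantity carries one factor [ln p] and [(n J)^2] carries two; the lower bound on
   [ln p] makes up the difference. *)
have LL : ln p%:R <= 2 * ln p%:R ^+ 2 :> R.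
  by rewrite expr2 mulrA -[leLHS]mul1r ler_wpM2r//; lra.
have -> : 2 * D * (ln p%:R ^+ 2 * W) = (2 * ln p%:R ^+ 2) * (D * W) by ring.
by rewrite ler_wpM2r// mulr_ge0.
Qed.

End long_memory_rates.

(** * Dantzig-type bounds *)

Section dantzig.
Context {R : realType} {p : nat}.
Implicit Types (v theta eta b bh : 'cV[R]_p) (S Sigma M : 'M[R]_p).

Lemma le_supnorm v j : `|v j ord0| <= supnorm v.
Proof. by rewrite /supnorm; exact: le_bigmax. Qed.

Lemma supnorm_ge0 v : 0 <= supnorm v.
Proof. by rewrite /supnorm; exact: bigmax_ge_id. Qed.

Lemma supnorm_le v (c : R) : 0 <= c -> (forall j, `|v j ord0| <= c) -> supnorm v <= c.
Proof. by move=> c0 vc; rewrite /supnorm; apply: bigmax_le. Qed.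

Lemma l1norm_ge0 v : 0 <= l1norm v.
Proof. exact: sumr_ge0. Qed.

Lemma supnormD v1 v2 : supnorm (v1 + v2) <= supnorm v1 + supnorm v2.
Proof.
apply: supnorm_le => [|j]; first by rewrite addr_ge0 ?supnorm_ge0.
by rewrite mxE; apply: le_trans (ler_normD _ _) _; rewrite lerD ?le_supnorm.
Qed.

Lemma supnormN v : supnorm (- v) = supnorm v.
Proof. by rewrite /supnorm; apply: eq_bigr => j _; rewrite mxE normrN. Qed.

Lemma supnorm_mulmx M v (c : R) : 0 <= c -> (forall j k, `|M j k| <= c) ->
  supnorm (M *m v) <= c * l1norm v.
Proof.
move=> c0 Mc; apply: supnorm_le => [|j]; first by rewrite mulr_ge0 ?l1norm_ge0.
rewrite mxE; apply: le_trans (ler_norm_sum _ _ _) _.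
by rewrite mulr_sumr; apply: ler_sum => k _; rewrite normrM ler_wpM2r.
Qed.

Lemma L1mxnorm_ge0 M : 0 <= L1mxnorm M.
Proof. by rewrite /L1mxnorm; exact: bigmax_ge_id. Qed.

(** [L1mxnorm] is a maximal column sum; symmetry turns it into the row sum that controls the sup
    norm. *)
Lemma supnorm_symmetric_mulmx M v : M^T = M -> supnorm (M *m v) <= L1mxnorm M * supnorm v.
Proof.
move=> symM; apply: supnorm_le => [|j]; first by rewrite mulr_ge0 ?supnorm_ge0 ?L1mxnorm_ge0.
rewrite mxE; apply: le_trans (ler_norm_sum _ _ _) _.
apply: le_trans (_ : (\sum_k `|M k j|) * supnorm v <= _).
  rewrite mulr_suml; apply: ler_sum => k _.
  by rewrite normrM -{1}symM mxE ler_wpM2l// le_supnorm.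
rewrite ler_wpM2r ?supnorm_ge0// /L1mxnorm.
exact: (le_bigmax _ (fun k => \sum_(j < p) `|M j k|)).
Qed.

(** No support is singled out: [|eta_j - theta_j| + |theta_j| - |eta_j|] is at most [2 |theta_j|]
    and at most [2 |eta_j - theta_j|], hence at most [2 min(|theta_j|, u)], as [u] exceeds the
    sup-norm error. After summation, minimality of the l1 norm of [eta] removes the last two
    terms. *)
Lemma dantzig_bounds S Sigma b bh (e delta lam : R) eta :
  Sigma \in unitmx -> Sigma^T = Sigma -> 0 <= delta ->
  supnorm (bh - b) <= e -> (forall j k, `|(S - Sigma) j k| <= delta) ->
  e + delta * l1norm (invmx Sigma *m b) <= lam ->
  is_solution S bh lam eta ->
  supnorm (eta - invmx Sigma *m b) <= 2 * L1mxnorm (invmx Sigma) * lam /\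
  l1norm (eta - invmx Sigma *m b) <=
    6 * Dfun (invmx Sigma *m b) (5 * L1mxnorm (invmx Sigma) * lam).
Proof.
set theta := invmx Sigma *m b; set L := L1mxnorm _.
move=> uS symS d0 be Sd elam [feas opt].
have Sth : Sigma *m theta = b by rewrite mulKVmx.
have dec v : S *m v - bh = (S - Sigma) *m v + (Sigma *m v - b) - (bh - b).
  by rewrite mulmxBl; apply/matrixP => i j; rewrite !mxE; ring.
have etal1 : l1norm eta <= l1norm theta.
  apply: opt; rewrite dec Sth subrr addr0.
  apply: le_trans (supnormD _ _) _; rewrite supnormN addrC; apply: le_trans elam.
  by apply: lerD => //; exact: supnorm_mulmx.
have sup : supnorm (eta - theta) <= 2 * L * lam.
  have -> : eta - theta = invmx Sigma *m (Sigma *m eta - b).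
    by rewrite mulmxBr mulKmx.
  have symI : (invmx Sigma)^T = invmx Sigma by rewrite trmx_inv symS.
  apply: le_trans (supnorm_symmetric_mulmx _ _ symI) _.
  rewrite -/L mulrAC mulrC ler_wpM2r ?L1mxnorm_ge0//.
  have -> : Sigma *m eta - b = (S *m eta - bh) + (bh - b) - (S - Sigma) *m eta.
    by rewrite dec; apply/matrixP => i j; rewrite !mxE; ring.
  apply: le_trans (supnormD _ _) _; rewrite supnormN.
  have h1 := supnormD (S *m eta - bh) (bh - b).
  have h2 : supnorm ((S - Sigma) *m eta) <= delta * l1norm theta.
    apply: le_trans (supnorm_mulmx _ _ _ d0 Sd) _.
    by rewrite ler_wpM2l.
  by lra.
split => //.
set u := 5 * L * lam.
have lam0 : 0 <= L * lam.
  by have := le_trans (supnorm_ge0 _) sup; rewrite -mulrA; lra.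
have elt j : `|(eta - theta) j ord0| + `|theta j ord0| - `|eta j ord0| <=
    2 * Num.min `|theta j ord0| u.
  have dj : `|(eta - theta) j ord0| <= 2 * L * lam := le_trans (le_supnorm _ _) sup.
  have t1 : `|theta j ord0| <= `|eta j ord0| + `|(eta - theta) j ord0|.
    have -> : theta j ord0 = eta j ord0 - (eta - theta) j ord0 by rewrite !mxE; ring.
    exact: ler_normB.
  have t2 : `|(eta - theta) j ord0| <= `|eta j ord0| + `|theta j ord0|.
    by rewrite !mxE; exact: ler_normB.
  by rewrite /u minEle; case: ifP => _; lra.
have : \sum_j (`|(eta - theta) j ord0| + `|theta j ord0| - `|eta j ord0|) <=
    2 * Dfun theta u.
  by rewrite /Dfun mulr_sumr; apply: ler_sum => j _; exact: elt.
rewrite sumrB big_split/= -/(l1norm (eta - theta)) -/(l1norm theta) -/(l1norm eta).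
have D0 : 0 <= Dfun theta u.
  by apply: sumr_ge0 => j _; rewrite le_min normr_ge0/= /u; lra.
by lra.
Qed.

Lemma invw_itv (w : \bar R) : (1 <= w)%E -> 0 <= invw w <= 1.
Proof.
case: w => [r| |]//=; last by rewrite lexx ler01.
rewrite lee_fin => r1; have r0 : 0 < r by apply: lt_le_trans r1.
by rewrite invr_ge0 ltW//= invf_le1.
Qed.

(** From [|v_j|^w <= |v_j| s^(w-1)]. At [w = +oo] the first factor is [a^0], which is 1 even for
    [a = 0]. *)
Lemma lwnorm_interpolation (w : \bar R) v (a s : R) : (1 <= w)%E ->
  l1norm v <= a -> supnorm v <= s ->
  lwnorm w v <= a `^ invw w * s `^ (1 - invw w).
Proof.
move=> w1 va vs.
have a0 := le_trans (l1norm_ge0 v) va.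
have s0 := le_trans (supnorm_ge0 v) vs.
case: w w1 => [r| |]//= r1; last first.
  by rewrite powRr0 mul1r subr0 powRr1.
rewrite lee_fin in r1; have r0 : 0 < r by apply: lt_le_trans r1.
have -> : s `^ (1 - r^-1) = (s `^ (r - 1)) `^ r^-1.
  by rewrite -powRrM mulrBl mul1r divff// gt_eqF.
rewrite -powRM ?powR_ge0//.
apply: ge0_ler_powR.
- by rewrite invr_ge0 ltW.
- by rewrite nnegrE sumr_ge0// => j _; exact: powR_ge0.
- by rewrite nnegrE mulr_ge0 ?powR_ge0.
apply: le_trans (_ : l1norm v * s `^ (r - 1) <= _); last by rewrite ler_wpM2r ?powR_ge0.
rewrite mulr_suml; apply: ler_sum => j _.
rewrite -mulr_powRB1// ler_wpM2l//.
apply: ge0_ler_powR; rewrite ?nnegrE ?subr_ge0//.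
exact: le_trans (le_supnorm v j) vs.
Qed.

Lemma Gr_l1norm (r nu Mp : R) theta : 0 <= r < 1 -> in_Gr r nu Mp theta ->
  l1norm theta <= nu `^ (1 - r) * Mp.
Proof.
move=> /andP[r0 r1] [thnu thM].
apply: le_trans (ler_wpM2l (powR_ge0 _ _) thM).
rewrite mulr_sumr; apply: ler_sum => j _.
(* [powR] has [0^0 = 1], against the convention of [in_Gr], so null coordinates are treated
   apart. *)
case: eqP => [->|_]; first by rewrite normr0 mulr0.
have {1}-> : `|theta j ord0| = `|theta j ord0| `^ (1 - r) * `|theta j ord0| `^ r.
  by rewrite -powRD subrK ?powRr1// oner_eq0.
rewrite ler_wpM2r ?powR_ge0//.
apply: ge0_ler_powR; rewrite ?nnegrE//; first by rewrite subr_ge0 ltW.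
by apply: le_trans (thnu j).
Qed.

Lemma Gr_Dfun (r nu Mp u : R) theta : 0 <= r < 1 -> 0 <= u -> in_Gr r nu Mp theta ->
  Dfun theta u <= Mp * u `^ (1 - r).
Proof.
move=> /andP[r0 r1] u0 [_ thM].
apply: le_trans (ler_wpM2r (powR_ge0 _ _) thM).
rewrite mulr_suml; apply: ler_sum => j _.
case: eqP => [->|_]; first by rewrite normr0 mul0r ge_min lexx.
set m := Num.min _ u.
have m0 : 0 <= m by rewrite le_min normr_ge0.
have {1}-> : m = m `^ r * m `^ (1 - r).
  by rewrite -powRD addrC subrK ?powRr1// oner_eq0.
apply: ler_pM; rewrite ?powR_ge0//; apply: ge0_ler_powR; rewrite ?nnegrE//.
- by rewrite ge_min lexx.
- by rewrite subr_ge0 ltW.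
- by rewrite ge_min lexx orbT.
Qed.

(** [A] is such that [lam <= A * (Mp * J + rb)]; the numbers 6, 5 and 2 are those of the general
    error bound. *)
Definition sparse_const (r nu : R) (w : \bar R) (C1 cb : R) : R :=
  let A := cb + C1 * nu `^ (1 - r) in
  6 `^ invw w * (5 * A) `^ ((1 - r) * invw w) * (2 * A) `^ (1 - invw w).

Lemma sparse_rate (r nu Mp L J rb cb C1 lam : R) (w : \bar R) theta :
  0 <= r < 1 -> in_Gr r nu Mp theta -> (1 <= w)%E ->
  0 <= L -> 0 <= J -> 0 <= rb -> 0 <= cb -> 0 <= C1 -> 0 <= Mp ->
  lam = cb * rb + C1 * nu `^ (1 - r) * Mp * J ->
  (6 * Dfun theta (5 * L * lam)) `^ invw w * (2 * L * lam) `^ (1 - invw w) <=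
  sparse_const r nu w C1 cb * Mp `^ invw w * (L * (Mp * J + rb)) `^ (1 - r * invw w).
Proof.
move=> r01 Gr w1 L0 J0 rb0 cb0 C10 Mp0 lamE.
have /andP[r0 r1] := r01.
have /andP[i0 i1] := @invw_itv w w1.
rewrite /sparse_const; set A := cb + _; set Z := L * _; set i := invw w in i0 i1 *.
have nu0 : 0 <= nu `^ (1 - r) by exact: powR_ge0.
have A0 : 0 <= A by rewrite addr_ge0 ?mulr_ge0.
have Z0 : 0 <= Z by rewrite mulr_ge0 ?addr_ge0 ?mulr_ge0.
have MJ0 : 0 <= Mp * J by exact: mulr_ge0.
have lam0 : 0 <= lam by rewrite lamE addr_ge0 ?mulr_ge0.
have lamA : lam <= A * (Mp * J + rb).
  have h1 : 0 <= cb * (Mp * J) by exact: mulr_ge0.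
  have h2 : 0 <= C1 * nu `^ (1 - r) * rb by rewrite !mulr_ge0.
  by rewrite lamE /A; lra.
have LA : L * lam <= A * Z.
  by rewrite /Z mulrCA; apply: ler_wpM2l.
have LA0 : 0 <= L * lam by exact: mulr_ge0.
have D0 : 0 <= Dfun theta (5 * L * lam).
  by apply: sumr_ge0 => j _; rewrite le_min normr_ge0 !mulr_ge0.
have E (a z : R) : 0 <= a -> 0 <= z ->
     6 `^ i * (5 * a) `^ ((1 - r) * i) * (2 * a) `^ (1 - i) * Mp `^ i * z `^ (1 - r * i) =
     (6 * (Mp * (5 * a * z) `^ (1 - r))) `^ i * (2 * a * z) `^ (1 - i).
  move=> a0 z0; have a5 : 0 <= 5 * a by exact: mulr_ge0.
  have a2 : 0 <= 2 * a by exact: mulr_ge0.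
  have q0 : 0 <= (5 * a * z) `^ (1 - r) by exact: powR_ge0.
  rewrite (powRM (1 - i) a2 z0) (powRM i _ (mulr_ge0 Mp0 q0))//.
  rewrite (powRM i Mp0 q0) -powRrM (powRM _ a5 z0).
  have -> : 1 - r * i = (1 - r) * i + (1 - i) by ring.
  rewrite (@powRD _ z ((1 - r) * i) (1 - i)); first by ring.
  (* Adding exponents of a possibly null [z] requires a nonzero total [1 - r * i], which holds since
     [r < 1] and [i <= 1]. *)
  apply/implyP => /eqP h; exfalso; have : r * i < 1; last by lra.
  by apply: le_lt_trans r1; rewrite ler_piMr.
have r1' : 0 <= 1 - r by rewrite subr_ge0 ltW.
have i1' : 0 <= 1 - i by rewrite subr_ge0.
have u5 : 5 * L * lam <= 5 * A * Z by rewrite -!mulrA ler_wpM2l.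
have u2 : 2 * L * lam <= 2 * A * Z by rewrite -!mulrA ler_wpM2l.
have v5 : 0 <= 5 * L * lam by rewrite -mulrA mulr_ge0.
have v2 : 0 <= 2 * L * lam by rewrite -mulrA mulr_ge0.
have DM : Dfun theta (5 * L * lam) <= Mp * (5 * A * Z) `^ (1 - r).
  apply: le_trans (Gr_Dfun _ _ _ _ _ r01 v5 Gr) _.
  by rewrite ler_wpM2l// ge0_ler_powR// nnegrE (le_trans v5 u5).
rewrite E//; apply: ler_pM; rewrite ?powR_ge0//; apply: ge0_ler_powR => //;
  rewrite ?nnegrE//.
- by rewrite mulr_ge0.
- by rewrite mulr_ge0// mulr_ge0// powR_ge0.
- by rewrite ler_wpM2l.
- exact: le_trans v2 u2.
Qed.

End dantzig.

(** * Linear processes *)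

Section probability_tools.
Context {d : measure_display} {T : measurableType d} {R : realType}.
Variable P : probability T R.

Lemma mutually_independent_reindex {I : eqType} {J : finType} (X : I -> T -> R) (f : J -> I) :
  injective f -> mutually_independent P X -> mutually_independent P (fun j => X (f j)).
Proof.
move=> injf indX s B us mB.
pose B' i := if [pick j | f j == i] is Some j then B j else setT.
have B'f j : B' (f j) = B j.
  rewrite /B'; case: pickP => [k /eqP/injf -> //|/(_ j)]; by rewrite eqxx.
have := indX (map f s) B'; rewrite map_inj_uniq// => /(_ us) H.
have {}H := H (fun i => _); rewrite !big_map in H.
under eq_bigr do rewrite -B'f.
under [RHS]eq_bigr do rewrite -B'f.
apply: H => i; rewrite /B'; case: pickP => // j _; exact: mB.
Qed.

(** Young's inequality with weights [b / (2 a)] and [a / (2 b)], which avoids square roots. *)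
Lemma cauchy_schwarz_bound {J : finType} (f g : J -> R) (a b : R) : 0 < a -> 0 < b ->
  \sum_j f j ^+ 2 <= a ^+ 2 -> \sum_j g j ^+ 2 <= b ^+ 2 ->
  \sum_j `|f j| * `|g j| <= a * b.
Proof.
move=> a0 b0 fa gb.
apply: le_trans (_ : \sum_j ((2 * a)^-1 * b * f j ^+ 2 + (2 * b)^-1 * a * g j ^+ 2) <= _).
  apply: ler_sum => j _.
  have : 0 <= (2 * a * b)^-1 * (b * `|f j| - a * `|g j|) ^+ 2.
    by rewrite mulr_ge0 ?sqr_ge0// invr_ge0 !mulr_ge0// ltW.
  rewrite -(@real_normK _ (f j)) ?num_real// -(@real_normK _ (g j)) ?num_real//.
  have -> : (2 * a * b)^-1 * (b * `|f j| - a * `|g j|) ^+ 2 =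
     (2 * a)^-1 * b * `|f j| ^+ 2 + (2 * b)^-1 * a * `|g j| ^+ 2 - `|f j| * `|g j|.
    by field; rewrite !gt_eqF.
  by rewrite subr_ge0.
rewrite big_split/= -!mulr_sumr.
have -> : a * b = (2 * a)^-1 * b * a ^+ 2 + (2 * b)^-1 * a * b ^+ 2.
  by field; rewrite !gt_eqF.
by apply: lerD; rewrite ler_wpM2l// mulr_ge0 ?invr_ge0 ?mulr_ge0// ltW.
Qed.

Lemma chernoff_bound (Z : T -> R) (s t c : R) :
  measurable_fun setT Z -> 0 < s ->
  (\int[P]_w (expR (s * Z w))%:E <= c%:E)%E ->
  (P [set w | (t <= Z w)%R] <= (c * expR (- (s * t)))%:E)%E.
Proof.
move=> mZ s0 Ec.
pose ZM : {mfun T >-> R} := HB.pack Z (isMeasurableFun.Build _ _ _ _ _ mZ).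
apply: le_trans (@chernoff _ _ _ P ZM s t s0) _.
rewrite EFinM; apply: lee_wpmul2r; first by rewrite lee_fin expR_ge0.
rewrite /mmt_gen_fun unlock; apply: le_trans Ec.
rewrite le_eqVlt; apply/orP; left; apply/eqP; apply: eq_integral => w _ /=.
by rewrite mulrC.
Qed.

(** [1 + s E Z <= E e^(s Z) <= e^(C s^2)]; dividing by [s] of either sign and letting [s] tend to 0
    leaves [E Z = 0]. This computes moments of an almost sure limit from exponential bounds
    alone. *)
Lemma subexp_mean0 (Z : T -> R) (s0 C : R) : measurable_fun setT Z -> 0 < s0 -> 0 <= C ->
  (forall s, `|s| <= s0 -> (\int[P]_w (expR (s * Z w))%:E <= (expR (C * s ^+ 2))%:E)%E) ->
  P.-integrable setT (EFin \o Z) /\ (\int[P]_w (Z w)%:E = 0)%E.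
Proof.
move=> mZ s00 C0 mgf.
have mexp s : measurable_fun setT (fun w => expR (s * Z w)).
  by apply: measurableT_comp => //; exact: measurable_funM.
have iexp s : `|s| <= s0 -> P.-integrable setT (EFin \o (fun w => expR (s * Z w))).
  move=> ss; apply/integrableP; split; first exact/measurable_EFinP.
  under eq_integral do rewrite /= ger0_norm ?expR_ge0//.
  exact: le_lt_trans (mgf s ss) (ltry _).
have iZ : P.-integrable setT (EFin \o Z).
  have i1 := iexp s0 _; rewrite ger0_norm ?(ltW s00)// in i1.
  have i2 := iexp (- s0) _; rewrite normrN ger0_norm ?(ltW s00)// in i2.
  (* [s0 |Z|] is at most the sum of the exponentials at [s0] and [- s0]. *)
  have [i3 _] := @integral_affine _ _ _ P _ _ s0^-1 s0^-1 0 (i1 (lexx _)) (i2 (lexx _)).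
  apply: (le_integrable measurableT) i3; first exact/measurable_EFinP.
  move=> w _ /=; rewrite lee_fin addr0.
  have s00' : 0 < s0^-1 by rewrite invr_gt0.
  have p1 := expR_gt0 (s0 * Z w); have p2 := expR_gt0 (- s0 * Z w).
  rewrite (@ger0_norm _ (_ + _)); last by rewrite addr_ge0// mulr_ge0// ltW.
  rewrite -mulrDr -(ler_pM2l s00) mulrA divff ?gt_eqF// mul1r.
  have e1 := expR_ge1Dx (s0 * Z w); have e2 := expR_ge1Dx (- s0 * Z w).
  by have [z|z] := leP 0 (Z w); [rewrite ger0_norm//|rewrite ltr0_norm//]; lra.
split => //.
have [m mE] : exists m : R, (\int[P]_w (Z w)%:E = m%:E)%E.
  by exists (fine (\int[P]_w (Z w)%:E)); rewrite fineK//; exact: integrable_fin_num.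
rewrite mE.
have key s : `|s| <= s0 -> C * s ^+ 2 <= 1 / 2 -> s * m <= 2 * (C * s ^+ 2).
  move=> ss Cs.
  have [i1 E1] := @integral_affine _ _ _ P _ _ s 0 1 iZ iZ.
  have : ((s * m + 1)%:E <= (expR (C * s ^+ 2))%:E)%E.
    apply: le_trans (mgf s ss).
    have -> : ((s * m + 1)%:E = \int[P]_w (s * Z w + 0 * Z w + 1)%:E)%E.
      by rewrite E1 mE !mul0e adde0.
    apply: le_integral => //; first exact: iexp.
    move=> w _; rewrite lee_fin mul0r addr0 addrC; exact: expR_ge1Dx.
  rewrite lee_fin => h1.
  have y0 : 0 <= C * s ^+ 2 by rewrite mulr_ge0 ?sqr_ge0.
  set y := C * s ^+ 2 in Cs h1 y0 *.
  have h2 : expR y * (1 - y) <= 1.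
    rewrite -[leRHS](expRxMexpNx_1 y) ler_pM2l ?expR_gt0//.
    by have := expR_ge1Dx (- y); lra.
  have E0 := expR_gt0 y.
  by nra.
have key2 s : 0 < s -> s <= s0 -> C * s ^+ 2 <= 1 / 2 -> `|m| <= 2 * (C * s).
  move=> sp ss Cs.
  have k1 := key s; rewrite ger0_norm ?(ltW sp)// in k1.
  have k2 := key (- s); rewrite normrN ger0_norm ?(ltW sp)// sqrrN in k2.
  rewrite -(ler_pM2l sp).
  have := k1 ss Cs; have := k2 ss Cs.
  by have [z|z] := leP 0 m; [rewrite ger0_norm//|rewrite ltr0_norm//]; lra.
have [->//|m0] := eqVneq m 0.
exfalso; have mp : 0 < `|m| by rewrite normr_gt0.
have C1 : 0 < (4 * (C + 1))^-1 by rewrite invr_gt0; lra.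
(* [e] is small enough for [C e <= |m| / 4], which contradicts [|m| <= 2 C e]. *)
set e := Num.min s0 (Num.min (4 * (C + 1))^-1 (`|m| * (4 * (C + 1))^-1)).
have e0 : 0 < e by rewrite !lt_min s00 C1 mulr_gt0.
have es0 : e <= s0 by rewrite ge_min lexx.
have e1 : e <= (4 * (C + 1))^-1 by rewrite !ge_min lexx orbT.
have e2 : e <= `|m| * (4 * (C + 1))^-1 by rewrite !ge_min lexx !orbT.
have cc : C * (4 * (C + 1))^-1 <= 1 / 4.
  by rewrite ler_pdivrMr; lra.
have Ce : C * e <= 1 / 4 by apply: le_trans (ler_wpM2l C0 e1) cc.
have ele1 : e <= 1.
  by apply: le_trans e1 _; rewrite invf_le1; lra.
have := key2 e e0 es0.
have -> : C * e ^+ 2 <= 1 / 2 by rewrite expr2 mulrA; have := ltW e0; nra.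
move=> /(_ isT) h.
have : C * e <= `|m| * (1 / 4).
  apply: le_trans (ler_wpM2l C0 e2) _.
  by rewrite mulrCA ler_wpM2l.
by lra.
Qed.

End probability_tools.

Section linear_process.
Context {d : measure_display} {T : measurableType d} {R : realType}.
Variable P : probability T R.
Context {p : nat} (A : nat -> 'M[R]_p) (xi : int -> int -> T -> R).
Variables (K beta C0 D : R).
Hypothesis mxi : forall i j, measurable_fun setT (xi i j).
Hypothesis indxi : mutually_independent P (fun ij : int * int => xi ij.1 ij.2).
Hypothesis K1 : 1 <= K.
Hypothesis mgfxi : forall i j a b, `|a| <= K^-1 ->
  (\int[P]_w (expR (a * (xi i j w ^+ 2 - 1) + b * xi i j w))%:E <=
    (expR (K * (a ^+ 2 + b ^+ 2)))%:E)%E.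
Hypothesis C0_gt0 : 0 < C0.
Hypothesis decay : forall m j, \sum_(k < p) A m j k ^+ 2 <= (C0 * powdecay beta m) ^+ 2.
Hypothesis D_ge0 : 0 <= D.
Hypothesis convD : forall h N,
    \sum_(0 <= m < N) powdecay beta m * powdecay beta (m + h) <= D * powdecay (covexp beta) h.
Hypothesis beta_gt : 1 / 2 < beta.

Definition autocov (N : nat) (j k : 'I_p) : R :=
  \sum_(0 <= m < N) \sum_(l < p) A m j l * A m k l.

(* Innovations are indexed backwards from time [tau]: the pair [(r, l)] stands for
   [xi (tau - r) (l + 1)], and [u] for the process at time [tau - u]. *)
Definition coef {M : nat} (j : 'I_p) (u : nat) (a : 'I_M * 'I_p) : R :=
  if (u <= a.1)%N then A (a.1 - u) j a.2 else 0.

Definition innov {M : nat} (tau : int) (a : 'I_M * 'I_p) : T -> R :=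
  xi (tau - (a.1 : nat)%:Z) ((a.2 : nat).+1 : int).

Definition xtrunc (M : nat) (tau : int) (j : 'I_p) (u : nat) (w : T) : R :=
  \sum_(a : 'I_M * 'I_p) coef j u a * innov tau a w.

Lemma sum_shift (M u : nat) (F : nat -> R) : (forall r, (r < u)%N -> F r = 0) ->
  \sum_(r < M) F r = \sum_(0 <= m < M - u) F (m + u)%N.
Proof.
move=> F0; rewrite -(big_mkord xpredT F).
have [Mu|uM] := leqP M u.
  rewrite (eqP (_ : M - u == 0)%N) ?subn_eq0// [RHS]big_geq//.
  by rewrite big_nat big1// => r /andP[_ rM]; rewrite F0// (leq_trans rM).
rewrite (big_cat_nat _ (n := u)) ?(ltnW uM)//= big_nat big1 ?add0r; last first.
  by move=> r /andP[_ ru]; exact: F0.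
by rewrite -{1}[u]add0n big_addn.
Qed.

(** All times share one window of [M] innovation dates ending at [tau], so that a single finite
    family carries the quadratic form; at time [tau - u] only [M - u] lags survive, a shift that
    disappears in the limit. *)
Lemma xtrunc_partial M tau j u w : xtrunc M tau j u w =
  \sum_(0 <= m < M - u) \sum_(k < p) A m j k * xi (tau - u%:Z - m%:Z) (k.+1 : int) w.
Proof.
rewrite /xtrunc.
pose F r := \sum_(k < p) (if (u <= r)%N then A (r - u) j k else 0) *
   xi (tau - r%:Z) (k.+1 : int) w.
transitivity (\sum_(r < M) F r).
  by rewrite pair_bigA.
rewrite (@sum_shift M u) => [|r ru]; last first.
  by rewrite /F leqNgt ru big1// => k _; rewrite mul0r.
apply: eq_bigr => m _; apply: eq_bigr => k _.
rewrite leq_addl addnK; congr (_ * xi _ _ _).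
by rewrite PoszD opprD addrA addrAC.
Qed.

Lemma coef_gram M j k u : \sum_(a : 'I_M * 'I_p) coef j u a * coef k u a = autocov (M - u) j k.
Proof.
pose F r := \sum_(l < p) (if (u <= r)%N then A (r - u) j l else 0) *
   (if (u <= r)%N then A (r - u) k l else 0).
transitivity (\sum_(r < M) F r); first by rewrite pair_bigA.
rewrite (@sum_shift M u) => [|r ru]; last first.
  by rewrite /F leqNgt ru big1// => l _; rewrite mul0r.
by apply: eq_bigr => m _; apply: eq_bigr => l _; rewrite leq_addl addnK.
Qed.

(** Adding both rows lets a single Gram-type matrix dominate the symmetrized product of coordinates
    [j] and [k]. *)
Definition abscoef {M : nat} (j k : 'I_p) (u : nat) (a : 'I_M * 'I_p) : R :=
  `|coef j u a| + `|coef k u a|.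

(** Only innovations with [r >= v] meet both supports; at lags [m] and [m + (v - u)], Cauchy-Schwarz
    and the decay give [4 C0^2] times a summand of the convolution. *)
Lemma abscoef_gram_le M j k u v : (u <= v)%N ->
  \sum_(a : 'I_M * 'I_p) abscoef j k u a * abscoef j k v a <=
    4 * C0 ^+ 2 * D * powdecay (covexp beta) (natdist u v).
Proof.
move=> uv.
pose g u r l : R := `|if (u <= r)%N then A (r - u) j l else 0| +
                `|if (u <= r)%N then A (r - u) k l else 0|.
pose F r := \sum_(l < p) g u r l * g v r l.
have -> : \sum_(a : 'I_M * 'I_p) abscoef j k u a * abscoef j k v a = \sum_(r < M) F r.
  by rewrite pair_bigA.
rewrite (@sum_shift M v) => [|r rv]; last first.
  rewrite /F big1// => l _.
  by rewrite /g [(v <= r)%N]leqNgt rv/= normr0 addr0 mulr0.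
have -> : natdist u v = (v - u)%N by rewrite /natdist; lia.
apply: le_trans (_ : \sum_(0 <= m < M - v)
   4 * C0 ^+ 2 * (powdecay beta m * powdecay beta (m + (v - u))) <= _); last first.
  rewrite -mulr_sumr -[leRHS]mulrA ler_wpM2l//.
  by rewrite pmulr_rge0// sqr_ge0.
apply: ler_sum => m _.
have Aab (m' : nat) : \sum_(l < p) (`|A m' j l| + `|A m' k l|) ^+ 2 <=
    (2 * C0 * powdecay beta m') ^+ 2.
  apply: le_trans (_ : 2 * \sum_(l < p) A m' j l ^+ 2 + 2 * \sum_(l < p) A m' k l ^+ 2 <= _).
    rewrite !mulr_sumr -big_split/=; apply: ler_sum => l _.
    rewrite -(@real_normK _ (A m' j l)) ?num_real// -(@real_normK _ (A m' k l)) ?num_real//.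
    have := sqr_ge0 (`|A m' j l| - `|A m' k l|); nra.
  have := decay m' j; have := decay m' k.
  have -> : (2 * C0 * powdecay beta m') ^+ 2 = 4 * (C0 * powdecay beta m') ^+ 2 by ring.
  by move: (_ ^+ 2) => z; move: (\sum_(l < p) _) (\sum_(l < p) _) => x1 x2; lra.
have F_le : F (m + v)%N = \sum_(l < p) `| `|A (m + (v - u))%N j l| + `|A (m + (v - u))%N k l| | *
     `| `|A m j l| + `|A m k l| |.
  rewrite /F; apply: eq_bigr => l _; rewrite /g leq_addl addnK.
  have -> : (u <= m + v)%N by rewrite (leq_trans uv) ?leq_addl.
  by rewrite addnBA// !(ger0_norm (addr_ge0 (normr_ge0 _) (normr_ge0 _))).
rewrite F_le; apply: le_trans (cauchy_schwarz_bound _ _ _ _ _ _ (Aab _) (Aab _)) _.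
- by rewrite !mulr_gt0 ?powdecay_gt0.
- by rewrite !mulr_gt0 ?powdecay_gt0.
by rewrite le_eqVlt; apply/orP; left; apply/eqP; ring.
Qed.

Lemma innov_indep M tau : mutually_independent P (fun a : 'I_M * 'I_p => innov tau a).
Proof.
pose f (a : 'I_M * 'I_p) : int * int := (tau - (a.1 : nat)%:Z, ((a.2 : nat).+1 : int)).
apply: (@mutually_independent_reindex _ _ _ P _ _ _ f) indxi.
move=> [r l] [r' l'] [] /addrI/oppr_inj [rr] ll.
by congr (_, _); apply/val_inj.
Qed.

Definition sampmajorant (n : nat) : 'M[R]_n :=
  covmajorant (covexp beta) (4 * C0 ^+ 2 * D) n.

(** The hypothesis is the smallness condition of [dominating_matrix] with [kappa = 8 K] and the
    [rho] of [covmajorant_sq]. The bound is free of [M], as the passage to the limit requires. *)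
Lemma xtrunc_quad_mgf M tau n (j k : 'I_p) (s : R) :
  4 * (8 * K) * `|s| * (4 * 2 `^ covexp beta * (4 * C0 ^+ 2 * D) *
     \sum_(0 <= h < n) powdecay (covexp beta) h) <= 1 ->
  (\int[P]_w (expR (s * (\sum_(u < n) (xtrunc M tau j u w * xtrunc M tau k u w) -
     \sum_(u < n) autocov (M - u) j k)))%:E <=
   (expR (8 * K * (4 * s ^+ 2 * \sum_u \sum_v sampmajorant n u v ^+ 2)))%:E)%E.
Proof.
move=> small.
set J := ('I_M * 'I_p)%type.
pose V : 'M[R]_(n, #|{: J}|) := \matrix_(u, a) abscoef j k u (enum_val a).
have C2 : 0 <= 4 * C0 ^+ 2 * D by rewrite mulr_ge0// pmulr_rge0// sqr_ge0.
have al0 : 0 <= covexp beta by rewrite ltW ?covexp_gt0.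
have V0 : lemx 0 V by move=> u a; rewrite !mxE addr_ge0.
have T0 : lemx 0 (sampmajorant n) by move=> u v; rewrite !mxE mulr_ge0 ?powdecay_ge0.
have symT : (sampmajorant n)^T = sampmajorant n.
  by apply/matrixP => u v; rewrite !mxE natdistC.
have GT : lemx (V *m V^T) (sampmajorant n).
  move=> u v; rewrite !mxE.
  have -> : \sum_i V u i * V^T i v = \sum_(a : J) abscoef j k u a * abscoef j k v a.
    rewrite [RHS](reindex _ (onW_bij _ (enum_val_bij J))).
    by apply: eq_bigr => a _; rewrite !mxE.
  have [uv|/ltnW vu] := leqP u v; first exact: abscoef_gram_le.
  rewrite natdistC; under eq_bigr do rewrite mulrC.
  exact: abscoef_gram_le.
have TT := @covmajorant_sq R (covexp beta) (4 * C0 ^+ 2 * D) n al0 C2.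
have K0 : 0 <= 8 * K by rewrite mulr_ge0// (le_trans ler01).
set rho := 4 * 2 `^ covexp beta * _ * _ in small TT.
have rho0 : 0 <= rho.
  apply: mulr_ge0; last by apply: sumr_ge0 => h _; exact: powdecay_ge0.
  by rewrite mulr_ge0// mulr_ge0// powR_ge0.
have [G [G0 symG BG FG]] := @dominating_matrix R n _ V (sampmajorant n) rho (8 * K) `|s|
   V0 T0 symT GT TT (normr_ge0 s) K0 rho0 small.
(* The product of the two coordinates is symmetrized because the elimination works with symmetric
   matrices; the result is entrywise at most [|s| V^T V]. *)
pose B (a b : J) : R := s * 2^-1 * \sum_(u < n) (coef j u a * coef k u b + coef k u a * coef j u b).
pose Gf (a b : J) : R := G (enum_rank a) (enum_rank b).
have K00 : 0 < K by apply: lt_le_trans K1.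
have sumE (f : 'I_#|{: J}| -> R) : \sum_(a : J) f (enum_rank a) = \sum_i f i.
  by rewrite [RHS](reindex _ (onW_bij _ (enum_rank_bij J))).
have := @hanson_wright_mgf d T R P J (fun a => innov tau a) K _ (innov_indep M tau) K1 _
   (index_enum J) B Gf (fun=> 0) (index_enum_uniq J).
move=> /(_ (fun a => mxi _ _) (fun a => mgfxi _ _)).
have symB a b : B a b = B b a.
  by rewrite /B; congr (_ * _); apply: eq_bigr => u _; ring.
have symGf a b : Gf a b = Gf b a by rewrite /Gf -{1}symG mxE.
have Gf0 a b : 0 <= Gf a b by have := G0 (enum_rank a) (enum_rank b); rewrite mxE.
move=> /(_ symB symGf Gf0) => H.
have {}H := H _.
have BGf : forall a b : J, a \in index_enum J -> b \in index_enum J ->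
    `|B a b| + 8 * K * \sum_(c <- index_enum J) Gf a c * Gf c b <= Gf a b.
  move=> a b _ _; have := BG (enum_rank a) (enum_rank b).
  rewrite !mxE => h; apply: le_trans h; apply: lerD; last first.
    by rewrite (sumE (fun i => G (enum_rank a) i * G i (enum_rank b))).
  rewrite /B normrM normrM -mulrA ler_wpM2l//.
  apply: le_trans (_ : 2^-1 * \sum_(u < n) 2 * (abscoef j k u a * abscoef j k u b) <= _).
    rewrite ger0_norm// ler_wpM2l//; apply: le_trans (ler_norm_sum _ _ _) _.
    apply: ler_sum => u _; apply: le_trans (ler_normD _ _) _; rewrite !normrM /abscoef.
    set x1 := `|coef j u a|; set x2 := `|coef k u b|; set x3 := `|coef k u a|; set x4 := `|coef j u b|.
    have := mulr_ge0 (normr_ge0 (coef j u a)) (normr_ge0 (coef k u b)).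
    have := mulr_ge0 (normr_ge0 (coef k u a)) (normr_ge0 (coef j u b)).
    have := mulr_ge0 (normr_ge0 (coef j u a)) (normr_ge0 (coef j u b)).
    have := mulr_ge0 (normr_ge0 (coef k u a)) (normr_ge0 (coef k u b)).
    rewrite -/x1 -/x2 -/x3 -/x4; lra.
  rewrite -mulr_sumr mulrA mulVf// mul1r; apply: ler_sum => u _.
  by rewrite !mxE !enum_rankK.
move: (H BGf) => {H}.
rewrite [X in _ + X](_ : \sum_(i <- index_enum J) 0 ^+ 2 = 0); last first.
  by rewrite big1// => i _; rewrite expr0n.
rewrite addr0 => H.
have FGf : \sum_(a <- index_enum J) \sum_(b <- index_enum J) Gf a b ^+ 2 = \sum_a \sum_b G a b ^+ 2.
  rewrite -sumE; apply: eq_bigr => a _.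
  by rewrite (sumE (fun i => G (enum_rank a) i ^+ 2)).
rewrite FGf in H.
apply: le_trans (le_trans H _); last first.
  rewrite lee_fin ler_expR ler_wpM2l//; apply: le_trans FG _.
  by rewrite real_normK// num_real.
rewrite le_eqVlt; apply/orP; left; apply/eqP; apply: eq_integral => w _.
congr (expR _)%:E; rewrite /centered_quad.
rewrite [X in _ = _ + X]big1 ?addr0; last by move=> a _; rewrite mul0r.
rewrite mulrBr; congr (_ - _).
- have -> : \sum_(a <- index_enum J) \sum_(b <- index_enum J) B a b * innov tau a w * innov tau b w =
    \sum_(u < n) (s * 2^-1) * ((xtrunc M tau j u w * xtrunc M tau k u w) +
        (xtrunc M tau k u w * xtrunc M tau j u w)).
    under eq_bigr do under eq_bigr do rewrite /B -!mulrA mulr_suml mulrA mulr_sumr.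
    under eq_bigr do rewrite exchange_big/=.
    rewrite exchange_big/=; apply: eq_bigr => u _.
    rewrite /xtrunc !mulr_suml -big_split/= mulr_sumr; apply: eq_bigr => a _.
    rewrite !mulr_sumr -big_split/= mulr_sumr; apply: eq_bigr => b _.
    ring.
  by rewrite mulr_sumr; apply: eq_bigr => u _; field.
- rewrite mulr_sumr.
  under [RHS]eq_bigr do rewrite /B mulr_sumr.
  rewrite exchange_big/=; apply: eq_bigr => u _.
  rewrite -coef_gram mulr_sumr; apply: eq_bigr => a _; by field.
Qed.

Lemma autocov_abs_le N j k : \sum_(0 <= m < N) `|\sum_(l < p) A m j l * A m k l| <= C0 ^+ 2 * D.
Proof.
apply: le_trans (_ : \sum_(0 <= m < N) C0 ^+ 2 * (powdecay beta m * powdecay beta (m + 0)) <= _).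
  apply: ler_sum => m _; apply: le_trans (ler_norm_sum _ _ _) _.
  under eq_bigr do rewrite normrM.
  apply: le_trans (cauchy_schwarz_bound _ _ _ _ _ _ (decay m j) (decay m k)) _.
  - by rewrite mulr_gt0 ?powdecay_gt0.
  - by rewrite mulr_gt0 ?powdecay_gt0.
  by rewrite addn0 le_eqVlt; apply/orP; left; apply/eqP; ring.
rewrite -mulr_sumr ler_wpM2l ?sqr_ge0//.
by apply: le_trans (convD _ _) _; rewrite powdecay0 mulr1.
Qed.

(** The case [B = G = 0] of the elimination bound. *)
Lemma xtrunc_linear_mgf M tau j (s : R) :
  (\int[P]_w (expR (s * xtrunc M tau j 0 w))%:E <=
   (expR (8 * K * (C0 ^+ 2 * D) * s ^+ 2))%:E)%E.
Proof.
set J := ('I_M * 'I_p)%type.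
have K00 : 0 < K by apply: lt_le_trans K1.
have H := @hanson_wright_mgf d T R P J (fun a => innov tau a) K (fun a => mxi _ _)
   (innov_indep M tau) K1 (fun a => mgfxi _ _)
   (index_enum J) (fun _ _ => 0) (fun _ _ => 0) (fun a => s * coef j 0 a) (index_enum_uniq J)
   (fun _ _ => erefl) (fun _ _ => erefl) (fun _ _ => lexx 0).
have {}H := H _.
have BG : forall a b : J, a \in index_enum J -> b \in index_enum J ->
    `|0 : R| + 8 * K * \sum_(c <- index_enum J) (0 : R) * 0 <= 0.
  by move=> a b _ _; rewrite normr0 add0r big1 ?mulr0// => c _; rewrite mulr0.
move: (H BG) => {BG}{}H.
rewrite [X in (_ <= (expR (_ * (X + _)))%:E)%E]big1 in H; last first.
  by move=> a _; rewrite big1// => b _; rewrite expr0n.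
apply: le_trans (le_trans H _).
  rewrite le_eqVlt; apply/orP; left; apply/eqP; apply: eq_integral => w _.
  congr (expR _)%:E; rewrite /centered_quad.
  rewrite big1 ?add0r; last by move=> a _; rewrite big1// => b _; rewrite !mul0r.
  rewrite big1 ?oppr0 ?add0r//.
  by rewrite /xtrunc mulr_sumr; apply: eq_bigr => a _; rewrite mulrA.
rewrite lee_fin ler_expR add0r -[leRHS]mulrA ler_wpM2l ?mulr_ge0 ?(ltW K00)//.
have -> : \sum_(a <- index_enum J) (s * coef j 0 a) ^+ 2 = s ^+ 2 * autocov M j j.
  rewrite -[in RHS](subn0 M) -coef_gram mulr_sumr.
  by apply: eq_bigr => a _; ring.
rewrite [leRHS]mulrC ler_wpM2l ?sqr_ge0//.
apply: le_trans (autocov_abs_le M j j); apply: ler_sum => m _; exact: ler_norm.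
Qed.

Definition autocov_lim (j k : 'I_p) : R := limn (fun N => autocov N j k).

Lemma autocov_cvg j k : (fun N => autocov N j k) @ \oo --> autocov_lim j k.
Proof.
pose g m := \sum_(l < p) A m j l * A m k l.
suff : cvgn (series g) by [].
apply: normed_cvg; apply: nondecreasing_is_cvgn.
  by apply: nondecreasing_series => m _ _; exact: normr_ge0.
exists (C0 ^+ 2 * D) => _ [N _ <-].
exact: autocov_abs_le.
Qed.

Lemma cvg_bigsum {J : Type} (r : seq J) (f : J -> nat -> R) (l : J -> R) :
  (forall i, f i @ \oo --> l i) ->
  (fun M => \sum_(i <- r) f i M) @ \oo --> \sum_(i <- r) l i.
Proof.
move=> fl; elim: r => [|i r ih].
  by rewrite big_nil; under eq_fun do rewrite big_nil; exact: cvg_cst.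
by rewrite big_cons; under eq_fun do rewrite big_cons; exact: cvgD.
Qed.

Lemma cvg_subn (f : nat -> R) (l : R) (u : nat) :
  f @ \oo --> l -> (fun M => f (M - u)%N) @ \oo --> l.
Proof. by apply: cvg_comp; exact: cvg_subnr. Qed.

Variable x : int -> 'I_p -> T -> R.
Hypothesis mx : forall i j, measurable_fun setT (x i j).
Hypothesis limx : forall i j, {ae P, forall om,
        (fun M : nat => \sum_(m < M) \sum_(k < p)
             A m j k * xi (i - (m : nat)%:Z) ((k : nat).+1 : int) om)
        @ \oo --> x i j om}.

Lemma xtrunc_cvg tau j u : {ae P, forall w,
  (fun M => xtrunc M tau j u w) @ \oo --> x (tau - u%:Z) j w}.
Proof.
apply: filterS (limx (tau - u%:Z) j) => w cw.
under eq_fun do rewrite xtrunc_partial.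
apply: (@cvg_subn (fun M => \sum_(0 <= m < M) \sum_(k < p) A m j k *
   xi (tau - u%:Z - m%:Z) (k.+1 : int) w)).
by under eq_fun do rewrite big_mkord.
Qed.

Lemma xtrunc_measurable M tau j u : measurable_fun setT (xtrunc M tau j u).
Proof. by apply: measurable_sum => a; apply: measurable_funM => //; exact: mxi. Qed.

Lemma process_quad_measurable tau n j k :
  measurable_fun setT (fun w => \sum_(u < n) (x (tau - (u : nat)%:Z) j w * x (tau - (u : nat)%:Z) k w)).
Proof. by apply: measurable_sum => u; exact: measurable_funM. Qed.

Lemma process_quad_mgf tau n (j k : 'I_p) (s : R) :
  4 * (8 * K) * `|s| * (4 * 2 `^ covexp beta * (4 * C0 ^+ 2 * D) *
     \sum_(0 <= h < n) powdecay (covexp beta) h) <= 1 ->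
  (\int[P]_w (expR (s * (\sum_(u < n) (x (tau - (u : nat)%:Z) j w * x (tau - (u : nat)%:Z) k w) -
     n%:R * autocov_lim j k)))%:E <=
   (expR (8 * K * (4 * s ^+ 2 * \sum_u \sum_v sampmajorant n u v ^+ 2)))%:E)%E.
Proof.
move=> small.
apply: (@fatou_bound _ _ _ P (fun M w => expR (s * (\sum_(u < n) (xtrunc M tau j u w * xtrunc M tau k u w) -
     \sum_(u < n) autocov (M - u) j k)))).
- move=> M; apply: measurableT_comp => //; apply: measurable_funM => //.
  apply: measurable_funB => //; apply: measurable_sum => u.
  by apply: measurable_funM; exact: xtrunc_measurable.
- by move=> M w; exact: expR_ge0.
- apply: measurableT_comp => //; apply: measurable_funM => //.
  by apply: measurable_funB => //; exact: process_quad_measurable.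
- have cj : {ae P, forall w, forall u : 'I_n,
     (fun M => xtrunc M tau j u w) @ \oo --> x (tau - (u : nat)%:Z) j w}.
    by apply: filter_forall => u; exact: xtrunc_cvg.
  have ck : {ae P, forall w, forall u : 'I_n,
     (fun M => xtrunc M tau k u w) @ \oo --> x (tau - (u : nat)%:Z) k w}.
    by apply: filter_forall => u; exact: xtrunc_cvg.
  apply: filterS2 cj ck => w cj ck.
  apply: continuous_cvg; first exact: continuous_expR.
  apply: cvgMr; apply: cvgB.
    by apply: cvg_bigsum => u; apply: cvgM; [exact: cj|exact: ck].
  have -> : n%:R * autocov_lim j k = \sum_(u < n) autocov_lim j k.
    by rewrite sumr_const card_ord mulr_natl.
  by apply: cvg_bigsum => u; apply: (@cvg_subn (fun N => autocov N j k)); exact: autocov_cvg.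
- by move=> M; exact: xtrunc_quad_mgf.
Qed.

Lemma process_linear_mgf i j (s : R) :
  (\int[P]_w (expR (s * x i j w))%:E <= (expR (8 * K * (C0 ^+ 2 * D) * s ^+ 2))%:E)%E.
Proof.
apply: (@fatou_bound _ _ _ P (fun M w => expR (s * xtrunc M i j 0 w))).
- move=> M; apply: measurableT_comp => //; apply: measurable_funM => //.
  exact: xtrunc_measurable.
- by move=> M w; exact: expR_ge0.
- by apply: measurableT_comp => //; exact: measurable_funM.
- apply: filterS (xtrunc_cvg i j 0) => w cw.
  apply: continuous_cvg; first exact: continuous_expR.
  by apply: cvgMr; rewrite subr0 in cw.
- by move=> M; exact: xtrunc_linear_mgf.
Qed.

Lemma process_mean0 i j : (\int[P]_w (x i j w)%:E = 0)%E.
Proof.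
have K0 : 0 <= 8 * K by rewrite mulr_ge0// (le_trans ler01).
have CD0 : 0 <= C0 ^+ 2 * D by rewrite mulr_ge0// sqr_ge0.
have [s _|//] := @subexp_mean0 _ _ _ P (x i j) 1 _ (mx i j) ltr01 (mulr_ge0 K0 CD0).
exact: process_linear_mgf.
Qed.

(** By [subexp_mean0], the centering constant of the case [n = 1] must be the mean of the product of
    the two coordinates. It does not depend on the time [i], whence second-order stationarity. *)
Lemma process_covariance i j k : fine (covariance P (x i j) (x i k)) = autocov_lim j k.
Proof.
set Z := fun w => \sum_(u < 1) (x (i - (u : nat)%:Z) j w * x (i - (u : nat)%:Z) k w) - 1%:R * autocov_lim j k.
have ZE w : Z w = x i j w * x i k w - autocov_lim j k.
  by rewrite /Z big_ord1 subr0 mul1r.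
have mZ : measurable_fun setT Z.
  by apply: measurable_funB => //; exact: process_quad_measurable.
set rho := 4 * 2 `^ covexp beta * (4 * C0 ^+ 2 * D) *
     \sum_(0 <= h < 1) powdecay (covexp beta) h.
have K0 : 0 <= 8 * K by rewrite mulr_ge0// (le_trans ler01).
have rho0 : 0 <= rho.
  apply: mulr_ge0; last by apply: sumr_ge0 => h _; exact: powdecay_ge0.
  have C2 : 0 <= 4 * C0 ^+ 2 * D by rewrite mulr_ge0// pmulr_rge0// sqr_ge0.
  by rewrite mulr_ge0// mulr_ge0// powR_ge0.
have r0 : 0 < 1 + 4 * (8 * K) * rho by rewrite ltr_pwDl// mulr_ge0// mulr_ge0.
have F0 : 0 <= 8 * K * (4 * \sum_u \sum_v sampmajorant 1 u v ^+ 2).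
  rewrite mulr_ge0// mulr_ge0//; apply: sumr_ge0 => u _; apply: sumr_ge0 => v _.
  exact: sqr_ge0.
(* The range of [s] on which the smallness condition holds; the 1 keeps the denominator positive. *)
have s00 : 0 < (1 + 4 * (8 * K) * rho)^-1 by rewrite invr_gt0.
have [s|iZ EZ] := @subexp_mean0 _ _ _ P Z _ _ mZ s00 F0.
  move=> ss; rewrite /Z; apply: le_trans (process_quad_mgf _ _ _ _ _ _) _.
    rewrite -/rho -mulrA mulrCA [_ * rho]mulrC; apply: le_trans (ler_wpM2r _ ss) _.
      by rewrite mulr_ge0// mulr_ge0.
    rewrite ler_pdivrMl// mulr1; lra.
  by rewrite lee_fin ler_expR le_eqVlt; apply/orP; left; apply/eqP; ring.
have EX j' : ('E_P[x i j'] = 0)%E by rewrite unlock process_mean0.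
rewrite unlock !EX unlock.
have [_ E] := @integral_affine _ _ _ P _ _ 1 0 (autocov_lim j k) iZ iZ.
rewrite EZ !mule0 !add0e in E.
transitivity (fine (\int[P]_w (1 * Z w + 0 * Z w + autocov_lim j k)%:E)%E); last by rewrite E.
congr fine; apply: eq_integral => w _; congr EFin.
transitivity ((x i j w - 0) * (x i k w - 0)); first by [].
by rewrite ZE; ring.
Qed.

End linear_process.

(** * Concentration of the sample covariance *)

Section concentration.
Context {R : realType}.

Lemma union_bound {d : measure_display} {T : measurableType d} (P : probability T R)
  {J : Type} (r : seq J) (B : J -> set T) (c : R) :
  (forall i, measurable (B i)) -> (forall i, P (B i) <= c%:E)%E ->
  (P (\big[setU/set0]_(i <- r) B i) <= (c *+ size r)%:E)%E.
Proof.
move=> mB Bc; elim: r => [|i r ih]; first by rewrite big_nil measure0.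
rewrite big_cons/= mulrS EFinD; apply: le_trans (measureU2 _ _ _) _ => //.
  exact: bigsetU_measurable.
exact: leeD (Bc i) ih.
Qed.

(** The sample times are read backwards from [n], in the indexing of the truncated process with
    [tau = n]. *)
Lemma Sn_entry {T : Type} (p n : nat) (x : int -> 'I_p -> T -> R) (om : T) j k :
  Sn x n om j k = n%:R^-1 * \sum_(u < n) (x (n%:Z - (u : nat)%:Z) j om * x (n%:Z - (u : nat)%:Z) k om).
Proof.
rewrite /Sn mxE summxE; congr (_ * _).
rewrite -(big_mkord xpredT (fun u : nat => x (n%:Z - u%:Z) j om * x (n%:Z - u%:Z) k om)).
rewrite big_add1/= big_nat_rev/= add0n; apply: eq_big_nat => u /andP[_ un].
rewrite !mxE big_ord1 !mxE.
by have -> : ((n - u.+1).+1%:Z = n%:Z - u%:Z)%R by lia.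
Qed.

Lemma measurable_superlevel {d : measure_display} {T : measurableType d} (Y : T -> R) (t : R) :
  measurable_fun setT Y ->
  measurable [set w | t < Y w] /\ measurable [set w | t <= Y w].
Proof.
move=> mY; split.
  have -> : [set w | t < Y w] = setT `&` Y @^-1` [set` `]t, +oo[].
    by apply/seteqP; split => w /=; rewrite in_itv/= andbT; [split|case].
  exact: mY.
have -> : [set w | t <= Y w] = setT `&` Y @^-1` [set` `[t, +oo[].
  by apply/seteqP; split => w /=; rewrite in_itv/= andbT; [split|case].
exact: mY.
Qed.

Lemma abs_tail_bound {d : measure_display} {T : measurableType d} (P : probability T R)
  (Z : T -> R) (s t B : R) : measurable_fun setT Z -> 0 < s ->
  (\int[P]_w (expR (s * Z w))%:E <= (expR B)%:E)%E ->
  (\int[P]_w (expR (- s * Z w))%:E <= (expR B)%:E)%E ->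
  (P [set w | (t < `|Z w|)%R] <= (2 * expR (B - s * t))%:E)%E.
Proof.
move=> mZ s0 E1 E2.
have mNZ : measurable_fun setT (fun w => - Z w) by exact: measurableT_comp.
have m1 (Y : T -> R) : measurable_fun setT Y -> measurable [set w | (t <= Y w)%R].
  by move=> mY; have [] := measurable_superlevel Y t mY.
have E2' : (\int[P]_w (expR (s * - Z w))%:E <= (expR B)%:E)%E.
  by under eq_integral do rewrite mulrN -mulNr.
have b1 := chernoff_bound P Z s t (expR B) mZ s0 E1.
have b2 := chernoff_bound P (fun w => - Z w) s t (expR B) mNZ s0 E2'.
apply: le_trans (_ : (P ([set w | (t <= Z w)%R] `|` [set w | (t <= - Z w)%R]) <= _)%E).
  apply: le_measure; rewrite ?inE.
  - have mabs : measurable_fun setT (fun w => `|Z w|) by exact: measurableT_comp.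
    by have [] := measurable_superlevel _ t mabs.
  - by apply: measurableU; exact: m1.
  - move=> w /=; have [z|z] := leP 0 (Z w).
      by rewrite ger0_norm// => /ltW; left.
    by rewrite ltr0_norm// => /ltW; right.
apply: le_trans (measureU2 _ _ _) _; [exact: m1|exact: m1|].
apply: le_trans (leeD b1 b2) _.
by rewrite -EFinD lee_fin expRD mulr2n mulrDl !mul1r.
Qed.

(* [s = eps L / (n J)] turns both requirements of the Hanson-Wright bound into [rate_bounds]. *)
Lemma sample_covariance_concentration (beta C0 Cxi : R) :
  1 / 2 < beta -> beta != 3 / 4 -> beta != 1 ->
  exists2 C1 : R, 1 < C1 &
  forall (d : measure_display) (T : measurableType d) (P : probability T R)
    (p n : nat) (A : nat -> 'M[R]_p)
    (xi : int -> int -> T -> R) (x : int -> 'I_p -> T -> R),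
    (3 <= p)%N -> ln (p%:R : R) <= n%:R ->
    (forall (m : nat) (j : 'I_p),
        Num.sqrt (\sum_(k < p) A m j k ^+ 2) <= C0 * (maxn 1 m)%:R `^ (- beta)) ->
    (forall i j, measurable_fun setT (xi i j)) ->
    mutually_independent P (fun ij : int * int => xi ij.1 ij.2) ->
    identically_distributed P (fun ij : int * int => xi ij.1 ij.2) ->
    (forall i j, ('E_P[xi i j] = 0)%E /\ ('V_P[xi i j] = 1)%E) ->
    (forall q : R, 1 <= q ->
        ('N[P]_(q%:E)[EFin \o xi 1%:Z 1%:Z] <= (Cxi * Num.sqrt q)%:E)%E) ->
    (forall i j, measurable_fun setT (x i j)) ->
    (forall i j, {ae P, forall om,
        (fun M : nat => \sum_(m < M) \sum_(k < p)
             A m j k * xi (i - (m : nat)%:Z) ((k : nat).+1 : int) om)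
        @ \oo --> x i j om}) ->
    forall j k, (P [set om | (C1 * Jrate beta n p < `|(Sn x n om - covmx P (x 0)) j k|)%R] <=
      (2 * p%:R `^ (- 3))%:E)%E.
Proof.
move=> b12 b34 b1.
(* [Cxi] and [C0] come without a sign; they are enlarged to positive constants. *)
set C : R := `|Cxi| + 1; have Cp : 0 < C by rewrite /C; have := normr_ge0 Cxi; lra.
have [K K1 mgfK] := subgaussian_mgf C Cp.
set C0' : R := `|C0| + 1; have C0p : 0 < C0' by rewrite /C0'; have := normr_ge0 C0; lra.
have [D D0 convD] := powdecay_convolution beta b12 b1.
have [c cp rates] := rate_bounds beta b12 b34 b1.
have K0 : 0 < K by apply: lt_le_trans K1.
set al := covexp beta.
set cc := 4 * C0' ^+ 2 * D.
have cc0 : 0 <= cc by rewrite mulr_ge0// pmulr_rge0// sqr_ge0.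
(* With [s = e L / (n J)], the smallness condition follows from [e * a <= 1], and the mgf is at most
   [expR L] as soon as [e * (e * b) <= 1]. *)
pose a := 4 * (8 * K) * (4 * 2 `^ al * cc) * c.
pose b := 8 * K * (4 * (2 * cc ^+ 2)) * c.
have K8 : 0 <= 8 * K by rewrite mulr_ge0// ltW.
have K32 : 0 <= 4 * (8 * K) by rewrite mulr_ge0.
have t0 : 0 <= 4 * 2 `^ al * cc by rewrite mulr_ge0// mulr_ge0// powR_ge0.
have c20 : 0 <= 4 * (2 * cc ^+ 2) by rewrite mulr_ge0// mulr_ge0// sqr_ge0.
have a0 : 0 <= a by rewrite mulr_ge0 ?(ltW cp)// mulr_ge0.
have b0 : 0 <= b by rewrite mulr_ge0 ?(ltW cp)// mulr_ge0.
pose e := (1 + a + b)^-1.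
have ab0 : 0 < 1 + a + b by lra.
have e0 : 0 < e by rewrite invr_gt0.
have ea : e * a <= 1 by rewrite mulrC ler_pdivrMr// mul1r; lra.
have eb : e * b <= 1 by rewrite mulrC ler_pdivrMr// mul1r; lra.
have e1 : e <= 1 by rewrite invf_le1//; lra.
(* [s] times the level [4 e^-1 n J] is [4 L]; the mgf gives back [L], and [- 3 L] remains, that is
   [p^(-3)]. *)
exists (4 * e^-1).
  by rewrite /e invrK; lra.
move=> d T P p n A xi x p3 pn dec mxi indxi idxi EV mom mx limx j k.
have mgfxi i' j' a' b' : `|a'| <= K^-1 ->
    (\int[P]_w (expR (a' * (xi i' j' w ^+ 2 - 1) + b' * xi i' j' w))%:E <=
    (expR (K * (a' ^+ 2 + b' ^+ 2)))%:E)%E.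
  move=> aK.
  have [E11 V11] := EV 1%:Z 1%:Z.
  have mom' q : 1 <= q -> ('N[P]_(q%:E)[EFin \o xi 1%:Z 1%:Z] <= (C * Num.sqrt q)%:E)%E.
    move=> q1; apply: le_trans (mom q q1) _; rewrite lee_fin ler_wpM2r ?sqrtr_ge0//.
    by rewrite /C; have := ler_norm Cxi; lra.
  apply: le_trans (mgfK d T P (xi 1%:Z 1%:Z) (mxi _ _) E11 V11 mom' a' b' aK).
  rewrite le_eqVlt; apply/orP; left; apply/eqP.
  apply: (@ident_integral _ _ _ P _ (fun ij : int * int => xi ij.1 ij.2)
    (fun y => (expR (a' * (y ^+ 2 - 1) + b' * y))%:E) (i', j') (1%:Z, 1%:Z)) => //.
  - apply/measurable_EFinP; apply: measurableT_comp => //.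
    apply: measurable_funD; apply: measurable_funM => //.
    by apply: measurable_funB => //; exact: measurable_funX.
have dec' m j' : \sum_(k' < p) A m j' k' ^+ 2 <= (C0' * powdecay beta m) ^+ 2.
  have S0 : 0 <= \sum_(k' < p) A m j' k' ^+ 2 by apply: sumr_ge0 => k' _; exact: sqr_ge0.
  rewrite -(sqr_sqrtr S0) lerXn2r ?nnegrE ?sqrtr_ge0 ?mulr_ge0 ?powdecay_ge0 ?(ltW C0p)//.
  apply: le_trans (dec m j') _; apply: ler_wpM2r; first exact: powdecay_ge0.
  by apply: le_trans (ler_norm C0) _; rewrite /C0' lerDl.
have L0 : 1 / 2 <= ln (p%:R : R) := ln_ge_half p p3.
have n0 : (0 < n)%N by rewrite -(ltr0n R) (lt_le_trans _ pn)// (lt_le_trans _ L0)// divr_gt0.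
have N0 : 0 < n%:R :> R by rewrite ltr0n.
have [J0 rho_le F_le] := rates n p p3 pn.
set L := ln p%:R in L0 pn rho_le F_le.
set NJ := n%:R * Jrate beta n p in rho_le F_le.
have NJ0 : 0 < NJ by rewrite mulr_gt0.
have L1 : 0 < L by lra.
pose s := e * L / NJ.
have s0 : 0 < s by rewrite divr_gt0// mulr_gt0.
set S1 := \sum_(0 <= h < n) powdecay (covexp beta) h in rho_le.
set S2 := \sum_(0 <= h < n) powdecay (2 * covexp beta) h in F_le.
have small : 4 * (8 * K) * `|s| * (4 * 2 `^ covexp beta * (4 * C0' ^+ 2 * D) * S1) <= 1.
  rewrite (ger0_norm (ltW s0)) -/cc -/al.
  have -> : 4 * (8 * K) * s * (4 * 2 `^ al * cc * S1) =
    e * (4 * (8 * K) * (4 * 2 `^ al * cc)) * (L * S1) / NJ by rewrite /s; ring.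
  rewrite ler_pdivrMr// mul1r.
  apply: le_trans (ler_wpM2l _ rho_le) _.
    by rewrite mulr_ge0 ?(ltW e0)// mulr_ge0.
  have -> : e * (4 * (8 * K) * (4 * 2 `^ al * cc)) * (c * NJ) = e * a * NJ by rewrite /a; ring.
  by rewrite ler_piMl// ltW.
pose F := \sum_u \sum_v sampmajorant beta C0' D n u v ^+ 2.
have BL : 8 * K * (4 * s ^+ 2 * F) <= L.
  have F1 : F <= 2 * cc ^+ 2 * n%:R * S2 by exact: covmajorant_frobenius.
  have s2 : 0 <= 4 * s ^+ 2 by rewrite mulr_ge0// sqr_ge0.
  apply: le_trans (ler_wpM2l K8 (ler_wpM2l s2 F1)) _.
  have -> : 8 * K * (4 * s ^+ 2 * (2 * cc ^+ 2 * n%:R * S2)) =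
     e ^+ 2 * L * (8 * K * (4 * (2 * cc ^+ 2))) * (L * (n%:R * S2)) / NJ ^+ 2.
    by rewrite /s; field; rewrite gt_eqF.
  rewrite ler_pdivrMr ?exprn_gt0//.
  apply: le_trans (ler_wpM2l _ F_le) _.
    apply: mulr_ge0; last exact: mulr_ge0.
    by rewrite mulr_ge0 ?(ltW L1)// sqr_ge0.
  have -> : e ^+ 2 * L * (8 * K * (4 * (2 * cc ^+ 2))) * (c * NJ ^+ 2) =
    (e * (e * b)) * (L * NJ ^+ 2) by rewrite /b; ring.
  rewrite ler_piMl//; first by rewrite mulr_ge0 ?(ltW L1)// sqr_ge0.
  by rewrite mulr_ile1// ?mulr_ge0// ltW.
pose Z w := \sum_(u < n) (x (n%:Z - (u : nat)%:Z) j w * x (n%:Z - (u : nat)%:Z) k w) -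
   n%:R * autocov_lim A j k.
have mZ : measurable_fun setT Z.
  by apply: measurable_funB => //; exact: process_quad_measurable.
have mgfZ s' : `|s'| = `|s| -> (\int[P]_w (expR (s' * Z w))%:E <= (expR L)%:E)%E.
  move=> ss.
  apply: le_trans (@process_quad_mgf _ _ _ P _ A xi K beta C0' D mxi indxi K1 mgfxi C0p dec' D0
    convD b12 x mx limx n%:Z n j k s' _) _; first by rewrite ss.
  rewrite lee_fin ler_expR.
  by rewrite -(@real_normK _ s') ?num_real// ss real_normK ?num_real.
have := @abs_tail_bound _ _ P Z s (4 * e^-1 * NJ) L mZ s0 (mgfZ s erefl) (mgfZ (- s) (normrN s)).
have -> : L - s * (4 * e^-1 * NJ) = - 3 * L.
  by rewrite /s; field; rewrite !gt_eqF.
have -> : p%:R `^ (- 3) = expR (- 3 * L).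
  by rewrite /powR pnatr_eq0 gtn_eqF// (leq_trans _ p3).
have ZE om : `|(Sn x n om - covmx P (x 0)) j k| = n%:R^-1 * `|Z om|.
  rewrite -[n%:R^-1 in RHS]ger0_norm ?invr_ge0// -normrM; congr (`|_|).
  rewrite mxE Sn_entry [(- covmx _ _) _ _]mxE [covmx _ _ _ _]mxE.
  rewrite (@process_covariance _ _ _ P _ A xi K beta C0' D mxi indxi K1 mgfxi C0p dec' D0
    convD b12 x mx limx 0 j k).
  by rewrite /Z mulrBr mulrA mulVf ?mul1r// gt_eqF.
apply: le_trans; rewrite le_eqVlt; apply/orP; left; apply/eqP; congr (P _).
apply/seteqP; split => om /=; rewrite ZE ltr_pdivlMl//.
  by rewrite mulrCA.
by rewrite mulrCA.
Qed.

Lemma Jrate_ge0 (beta : R) (n p : nat) : (0 < p)%N -> 0 <= Jrate beta n p.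
Proof.
move=> p0; have L0 : 0 <= ln (p%:R : R) by rewrite ln_ge0// ler1n.
have L'0 : 0 <= ln p%:R / n%:R `^ (2 * beta - 1) by rewrite divr_ge0// powR_ge0.
rewrite /Jrate; case: ifP => _; first exact: sqrtr_ge0.
by case: ifP => _ //; rewrite le_max sqrtr_ge0.
Qed.

Lemma covmx_sym {d : measure_display} {T : measurableType d} (P : probability T R)
  (p : nat) (y : 'I_p -> T -> R) : (covmx P y)^T = covmx P y.
Proof. by apply/matrixP => j k; rewrite !mxE covarianceC. Qed.

(** Reduces measurability of sup-norm events to coordinates; the sign of [c] matters because the
    maximum starts at 0. *)
Lemma supnorm_superlevel {T : Type} (p : nat) (f : T -> 'cV[R]_p) (c : R) : 0 <= c ->
  [set om | c < supnorm (f om)] = \big[setU/set0]_(j <- enum 'I_p) [set om | c < `|f om j ord0|].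
Proof.
move=> c0; rewrite -bigcup_seq; apply/seteqP; split => om /=.
  move=> h; apply: contrapT => hn; move: h; apply/negP; rewrite -leNgt.
  apply: supnorm_le => // j; rewrite leNgt; apply/negP => hj; apply: hn.
  by exists j => //=; rewrite mem_enum.
by case=> j _ /= h; apply: lt_le_trans h (le_supnorm _ _).
Qed.

End concentration.

(** * Error bounds on the good event *)

Theorem theorem1 (R : realType) :
  exists C3 : R -> R -> \bar R -> R -> R -> R,
  forall beta C0 Cxi : R,
    1 / 2 < beta -> beta != 3 / 4 -> beta != 1 ->
  exists C1 C2 : R, 1 < C1 /\ 0 < C2 /\
  forall (d : measure_display) (T : measurableType d) (P : probability T R)
    (p n : nat) (A : nat -> 'M[R]_p)
    (xi : int -> int -> T -> R) (x : int -> 'I_p -> T -> R)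
    (b : 'cV[R]_p) (bhat : T -> 'cV[R]_p) (cb Cb rb : R),
    (3 <= p)%N ->
    ln (p%:R : R) <= n%:R ->
    (* decay condition *)
    (forall (m : nat) (j : 'I_p),
        Num.sqrt (\sum_(k < p) A m j k ^+ 2) <= C0 * (maxn 1 m)%:R `^ (- beta)) ->
    (* i.i.d. innovations, mean 0, variance 1, sub-Gaussian *)
    (forall i j, measurable_fun setT (xi i j)) ->
    mutually_independent P (fun ij : int * int => xi ij.1 ij.2) ->
    identically_distributed P (fun ij : int * int => xi ij.1 ij.2) ->
    (forall i j, ('E_P[xi i j] = 0)%E /\ ('V_P[xi i j] = 1)%E) ->
    (forall q : R, 1 <= q ->
        ('N[P]_(q%:E)[EFin \o xi 1%:Z 1%:Z] <= (Cxi * Num.sqrt q)%:E)%E) ->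
    (* the linear process x_i = sum_m A_m xi_{i-m} *)
    (forall i j, measurable_fun setT (x i j)) ->
    (forall i j, {ae P, forall om,
        (fun M : nat => \sum_(m < M) \sum_(k < p)
             A m j k * xi (i - (m : nat)%:Z) ((k : nat).+1 : int) om)
        @ \oo --> x i j om}) ->
    (* Sigma = cov(x_i) invertible *)
    covmx P (x 0) \in unitmx ->
    (* estimator of b *)
    (forall j, measurable_fun setT (fun om => bhat om j ord0)) ->
    0 < cb -> 0 < Cb -> 0 <= rb ->
    (P [set om | (cb * rb < supnorm (bhat om - b))%R] <= (2 * p%:R `^ (- Cb))%R%:E)%E ->
    let Sigma := covmx P (x 0) in
    let theta := invmx Sigma *m b in
    let L : R := L1mxnorm (invmx Sigma) in
    let J : R := Jrate beta n p in
    let prob : \bar R := (1 - 2 * p%:R `^ (- Cb) - 2 * p%:R `^ (- C2))%:E in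
    (forall lam : R, cb * rb + C1 * l1norm theta * J <= lam ->
      exists E : set T, measurable E /\ (prob <= P E)%E /\
        forall om, E om -> forall eta : 'cV[R]_p,
          is_solution (Sn x n om) (bhat om) lam eta ->
          forall w : \bar R, (1 <= w)%E ->
            lwnorm w (eta - theta) <=
            (6 * Dfun theta (5 * L * lam)) `^ (invw w) *
            (2 * L * lam) `^ (1 - invw w))
    /\
    (forall (r nu : R) (w : \bar R) (Mp : R),
      0 <= r < 1 -> 0 < nu -> (1 <= w)%E -> in_Gr r nu Mp theta ->
      let lam := cb * rb + C1 * nu `^ (1 - r) * Mp * J in
      exists E : set T, measurable E /\ (prob <= P E)%E /\
        forall om, E om -> forall eta : 'cV[R]_p,
          is_solution (Sn x n om) (bhat om) lam eta ->
            lwnorm w (eta - theta) <=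
            C3 r nu w C1 cb * Mp `^ (invw w) *
            (L * (Mp * J + rb)) `^ (1 - r * invw w)).

Proof.
exists sparse_const => beta C0 Cxi b12 b34 b1.
have [C1 C1gt conc] := sample_covariance_concentration beta C0 Cxi b12 b34 b1.
(* [C2 = 1]: there are [p^2] entries, each failing with probability at most [2 p^(-3)]. *)
exists C1, 1; split => //; split; first exact: ltr01.
move=> d T P p n A xi x b bhat cb Cb rb p3 pn dec mxi indxi idxi EV mom mx limx uS mbhat
  cb0 Cb0 rb0 Pb Sigma theta L J prob.
have Bp := conc d T P p n A xi x p3 pn dec mxi indxi idxi EV mom mx limx.
have p0 : (0 < p)%N by apply: leq_trans p3.
have pR : 0 < p%:R :> R by rewrite ltr0n.
have J0 : 0 <= J by exact: Jrate_ge0.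
have C10 : 0 <= C1 by rewrite (le_trans ler01)// ltW.
have e0 : 0 <= cb * rb by rewrite mulr_ge0// ltW.
have L0 : 0 <= L by exact: L1mxnorm_ge0.
pose B0 := [set om | cb * rb < supnorm (bhat om - b)].
pose B (jk : 'I_p * 'I_p) := [set om | C1 * J < `|(Sn x n om - Sigma) jk.1 jk.2|].
pose bad := \big[setU/set0]_(jk <- enum {: 'I_p * 'I_p}) B jk.
have mB0 : measurable B0.
  rewrite /B0 supnorm_superlevel//; apply: bigsetU_measurable => j _.
  have mj : measurable_fun setT (fun om => `|(bhat om - b) j ord0|).
    apply: measurableT_comp => //.
    under eq_fun do rewrite mxE.
    exact: measurable_funD.
  by have [] := measurable_superlevel _ (cb * rb) mj.
have mB jk : measurable (B jk).
  have mj : measurable_fun setT (fun om => `|(Sn x n om - Sigma) jk.1 jk.2|).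
    apply: measurableT_comp => //.
    under eq_fun do rewrite mxE Sn_entry.
    apply: measurable_funD => //; apply: measurable_funM => //.
    by apply: measurable_sum => u; exact: measurable_funM.
  by have [] := measurable_superlevel _ (C1 * J) mj.
have mbad : measurable bad by apply: bigsetU_measurable.
have Pbad : (P bad <= (2 * p%:R `^ (- 1))%:E)%E.
  apply: le_trans (union_bound P _ _ _ mB (fun jk => Bp jk.1 jk.2)) _.
  rewrite -cardE card_prod !card_ord lee_fin -[leLHS]mulr_natr natrM.
  rewrite le_eqVlt; apply/orP; left; apply/eqP.
  rewrite powR_invn ?(ltW pR)// powR_inv1 ?(ltW pR)//.
  by field; rewrite gt_eqF.
(* The event involves neither [lam] nor [w], hence the bounds hold for all [w] at once. *)
have good : exists E : set T, [/\ measurable E, (prob <= P E)%E &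
    forall om, E om -> supnorm (bhat om - b) <= cb * rb /\
      forall j k, `|(Sn x n om - Sigma) j k| <= C1 * J].
  exists (~` (B0 `|` bad)); split.
  - by apply: measurableC; exact: measurableU.
  - have mU : measurable (B0 `|` bad) by exact: measurableU.
    rewrite probability_setC//.
    have PU : (P (B0 `|` bad) <= (2 * p%:R `^ (- Cb) + 2 * p%:R `^ (- 1))%:E)%E.
      apply: le_trans (measureU2 _ mB0 mbad) _; rewrite EFinD.
      exact: leeD Pb Pbad.
    rewrite /prob; apply: le_trans (_ : (1 - (2 * p%:R `^ (- Cb) + 2 * p%:R `^ (- 1))%:E <= _)%E).
      by rewrite -EFinB lee_fin opprD addrA.
    exact: leeB.
  - move=> om /= /not_orP[nB0 nbad]; split.
      by rewrite leNgt; apply/negP.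
    move=> j k; rewrite leNgt; apply/negP => h; apply: nbad.
    by rewrite /bad -bigcup_seq; exists (j, k) => //=; rewrite mem_enum.
have main (lam : R) : cb * rb + C1 * l1norm theta * J <= lam ->
    exists E : set T, measurable E /\ (prob <= P E)%E /\
      forall om, E om -> forall eta : 'cV[R]_p,
        is_solution (Sn x n om) (bhat om) lam eta ->
        forall w : \bar R, (1 <= w)%E ->
          lwnorm w (eta - theta) <=
          (6 * Dfun theta (5 * L * lam)) `^ (invw w) *
          (2 * L * lam) `^ (1 - invw w).
  move=> hlam; have [E [mE PE HE]] := good; exists E; split => //; split => //.
  move=> om /HE[hb hS] eta sol w w1.
  have hlam' : cb * rb + C1 * J * l1norm theta <= lam by rewrite mulrAC.
  have CJ0 : 0 <= C1 * J by exact: mulr_ge0.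
  have [sup l1] := dantzig_bounds _ _ _ _ _ _ _ _ uS (covmx_sym P p (x 0)) CJ0 hb hS hlam' sol.
  exact: lwnorm_interpolation.
split => // r nu w Mp r01 nu0 w1 Gr lam.
have Mp0 : 0 <= Mp.
  apply: le_trans (Gr.2); apply: sumr_ge0 => j _.
  by case: ifP => // _; exact: powR_ge0.
(* On the sparsity class the l1 norm of [theta] is at most [nu^(1 - r) Mp], so this [lam] is
   admissible in the general bound. *)
have hlam : cb * rb + C1 * l1norm theta * J <= lam.
  rewrite /lam lerD2l ler_wpM2r// -mulrA ler_wpM2l//.
  exact: Gr_l1norm r01 Gr.
have [E [mE [PE HE]]] := main lam hlam.
exists E; split => //; split => // om Eom eta sol.
apply: le_trans (HE om Eom eta sol w w1) _.
by apply: sparse_rate => //; exact: ltW.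
Qed.
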